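(* Let $q=p^r$ for $p$ an odd prime. Let $\lambda\in\mathbb{F}_q$, $m\in\mathbb{Z}^{+}$, and $a_1,\dots,a_m,b_1,\dots,b_m\in\mathbb{Q}\cap\mathbb{Z}_p$. If $(\{a_i\}, \{b_i\})$ are defined over $\mathbb{Q}$ with corresponding exponents $(\{p_i : 1 \leq i \leq t \}, \{q_i : 1 \leq i \leq s \})$, then, with $\delta$, $\mathfrak{s}(\cdot)$ and $M$ as defined in the context, $${}_{m}G_{m}\left[ \begin{array}{cccc} a_1, & a_2, & \dots, & a_m \\ b_1, & b_2, & \dots, & b_m \end{array} \Big| \; \lambda \right]_q = \frac{-1}{q-1} \sum_{j=0}^{q-2} (-1)^{j(m+\delta)}\, q^{-\mathfrak{s}(0)+\mathfrak{s}(j)}\, \overline{\omega}^j(M \cdot\lambda) \prod_{k=0}^{r-1} \left( \prod_{i=1}^{t} \Gamma_p\left(\left\langle \tfrac{-j p_i}{q-1} p^k \right\rangle\right) (-p)^{-\left\lfloor \frac{-j p_i}{q-1} p^k \right\rfloor} \prod_{i=1}^{s} \Gamma_p\left(\left\langle \tfrac{j q_i}{q-1} p^k \right\rangle\right) (-p)^{-\left\lfloor \frac{j q_i}{q-1} p^k \right\rfloor}\right).$$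
   Context: $\mathbb{Z}_p$ is the ring of $p$-adic integers and $\Gamma_p$ is Morita's $p$-adic gamma function: $\Gamma_p(n):=(-1)^n\prod_{0<j<n,\,p\nmid j}j$ for $n\in\mathbb{Z}^+$, extended continuously to $\mathbb{Z}_p$, with $\Gamma_p(0)=1$. $\omega:\mathbb{F}_q^*\to\mathbb{Z}_q^{\times}$ is the Teichmüller character ($\mathbb{Z}_q$ the ring of integers of the unramified extension of $\mathbb{Q}_p$ with residue field $\mathbb{F}_q$; $\omega(x)$ is the $(q-1)$-st root of unity congruent to $x$ mod $p$), $\overline{\omega}$ is its inverse, and all powers (including the trivial one) are extended by the value $0$ at $0\in\mathbb{F}_q$. For $x\in\mathbb{Q}$, $\lfloor x\rfloor$ is the greatest integer less than or equal to $x$ and $\langle x\rangle=x-\lfloor x\rfloor$. Definition of ${}_mG_m$: for $q=p^r$, $p$ an odd prime, $\lambda\in\mathbb{F}_q$, $m\in\mathbb{Z}^+$, $a_i,b_i\in\mathbb{Q}\cap\mathbb{Z}_p$ ($1\le i\le m$), $${}_{m}G_{m}\left[ \begin{array}{ccc} a_1, & \dots, & a_m \\ b_1, & \dots, & b_m \end{array} \Big| \; \lambda \right]_q := \frac{-1}{q-1} \sum_{j=0}^{q-2} (-1)^{jm}\, \overline{\omega}^j(\lambda) \prod_{i=1}^{m} \prod_{k=0}^{r-1} \frac{\Gamma_p(\langle (a_i -\frac{j}{q-1} )p^k \rangle)}{\Gamma_p(\langle a_i p^k \rangle)} \frac{\Gamma_p(\langle (-b_i +\frac{j}{q-1}) p^k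 \rangle)}{\Gamma_p(\langle -b_i p^k\rangle)} (-p)^{-\lfloor\langle a_i p^k \rangle -\frac{j p^k}{q-1}\rfloor -\lfloor\langle -b_i p^k\rangle +\frac{j p^k}{q-1}\rfloor}.$$ Parameters defined over $\mathbb{Q}$: $(\{a_i\},\{b_i\})$ are defined over $\mathbb{Q}$ if there exist positive integers $p_1,\dots,p_t$ and $q_1,\dots,q_s$ (the corresponding exponents), with $t$ and $s$ minimal, such that $$\prod_{i=1}^{m} \frac{x- e^{2 \pi \mathrm{i} a_i}}{x- e^{2 \pi \mathrm{i} b_i}} = \frac{\prod_{i=1}^{t} (x^{p_i} - 1)}{\prod_{i=1}^{s} (x^{q_i} - 1)}.$$ Let $D(x):=\gcd\left(\prod_{i=1}^{t}(x^{p_i}-1),\prod_{i=1}^{s}(x^{q_i}-1)\right)$, of degree $\delta$, have zeros $\exp\left(\frac{2\pi\mathrm{i}\,c_h}{q-1}\right)$ for $1\le h\le\delta$, and let $\mathfrak{s}(c)$ denote the multiplicity of the zero $\exp\left(\frac{2\pi \mathrm{i}\,c}{q-1}\right)$ of $D(x)$ (equal to $0$ if it is not a zero). Finally $$M:=\frac{\prod_{i=1}^{t}p_i^{p_i}}{\prod_{i=1}^{s}q_i^{q_i}},$$ viewed in $\mathbb{F}_q$ in the expression $\overline{\omega}^j(M\cdot\lambda)$.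
   Formalization: The formal theorem additionally assumes that no difference a_i − b_j is an integer; without this the claim is false, e.g. p = q = 3, m = 1, a_1 = b_1 = 1/5, λ = 1, where the left side is −1 and the right side is 0. *)

(* Defs.v *)
From HB Require Import structures.
From mathcomp Require Import all_boot all_order all_algebra all_field.
From mathcomp Require Import all_classical all_reals all_analysis.
From mathcomp Require Import complex.

Set Implicit Arguments.
Unset Strict Implicit.
Unset Printing Implicit Defensive.

Import Order.TTheory GRing.Theory Num.Theory.

Local Open Scope classical_set_scope.
Local Open Scope ring_scope.

(* p-adic integers as the inverse limit of the rings Z/p^n: [x`_n] below is   *)
(* the residue of x modulo p^n.                                               *)
Record padic_int (p : nat) (p_pr : prime p) := PadicInt {
  padic_mod : nat -> nat;
  padic_modP : forall n, padic_mod n = (padic_mod n.+1 %% p ^ n)%N }.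

Section PadicInt.
Variables (p : nat) (p_pr : prime p).
Local Notation Zp := (padic_int p_pr).
Implicit Types x y z : Zp.

HB.instance Definition _ := gen_eqMixin Zp.
HB.instance Definition _ := gen_choiceMixin Zp.

Lemma padic_ext x y : (forall n, padic_mod x n = padic_mod y n) -> x = y.
Proof.
case: x y => [x Hx] [y Hy] /= /funext Exy; rewrite -{}Exy in Hy *.
by congr PadicInt; apply: Prop_irrelevance.
Qed.

Lemma padic_mod_modn x n : (padic_mod x n %% p ^ n)%N = padic_mod x n.
Proof. by rewrite (padic_modP x n) modn_mod. Qed.

Lemma padic_mod_le x m n : (m <= n)%N ->
  padic_mod x m = (padic_mod x n %% p ^ m)%N.
Proof.
move=> /subnK <-; elim: (n - m)%N => [|k IH]; first by rewrite padic_mod_modn.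
by rewrite IH (padic_modP x (k + m)) modn_dvdm // dvdn_exp2l // leq_addl.
Qed.

Fact padic_of_subproof (f : nat -> nat) :
    (forall n, f n.+1 = f n %[mod p ^ n])%N ->
  forall n, (f n %% p ^ n)%N = ((f n.+1 %% p ^ n.+1) %% p ^ n)%N.
Proof.
by move=> fP n; rewrite modn_dvdm ?dvdn_exp2l // fP.
Qed.

Definition padic_of (f : nat -> nat) fP : Zp :=
  PadicInt p_pr (@padic_of_subproof f fP).

Fact padic_nat_subproof (k : nat) :
  (forall n, (fun=> k) n.+1 = (fun=> k) n %[mod p ^ n])%N.
Proof. by []. Qed.
Definition padic_nat k : Zp := padic_of (@padic_nat_subproof k).

Fact padic_add_subproof x y n :
  (padic_mod x n.+1 + padic_mod y n.+1 =
   padic_mod x n + padic_mod y n %[mod p ^ n])%N.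
Proof. by rewrite (padic_modP x n) (padic_modP y n) modnDm. Qed.
Definition padic_add x y : Zp := padic_of (padic_add_subproof x y).

Fact padic_mul_subproof x y n :
  (padic_mod x n.+1 * padic_mod y n.+1 =
   padic_mod x n * padic_mod y n %[mod p ^ n])%N.
Proof. by rewrite (padic_modP x n) (padic_modP y n) modnMm. Qed.
Definition padic_mul x y : Zp := padic_of (padic_mul_subproof x y).

Fact padic_opp_subproof x n :
  ((p ^ n.+1).-1 * padic_mod x n.+1 = (p ^ n).-1 * padic_mod x n %[mod p ^ n])%N.
Proof.
rewrite (padic_modP x n) modnMmr; apply/eqP.
rewrite -(eqn_modDr (padic_mod x n.+1)) -!mulSnr !prednK ?expn_gt0 ?prime_gt0 //.
by rewrite expnS mulnAC modnMl modnMr.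
Qed.
Definition padic_opp x : Zp := padic_of (padic_opp_subproof x).

Fact padic_addA : associative padic_add.
Proof. by move=> x y z; apply: padic_ext => n /=; rewrite modnDmr modnDml addnA. Qed.
Fact padic_addC : commutative padic_add.
Proof. by move=> x y; apply: padic_ext => n /=; rewrite addnC. Qed.
Fact padic_add0 : left_id (padic_nat 0) padic_add.
Proof. by move=> x; apply: padic_ext => n /=; rewrite mod0n padic_mod_modn. Qed.
Fact padic_addN : left_inverse (padic_nat 0) padic_opp padic_add.
Proof.
move=> x; apply: padic_ext => n /=; rewrite modnDml -mulSnr.
by rewrite prednK ?expn_gt0 ?prime_gt0 // modnMr mod0n.
Qed.
Fact padic_mulA : associative padic_mul.
Proof. by move=> x y z; apply: padic_ext => n /=; rewrite modnMmr modnMml mulnA. Qed.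
Fact padic_mulC : commutative padic_mul.
Proof. by move=> x y; apply: padic_ext => n /=; rewrite mulnC. Qed.
Fact padic_mul1 : left_id (padic_nat 1) padic_mul.
Proof.
by move=> x; apply: padic_ext => n /=; rewrite modnMml mul1n padic_mod_modn.
Qed.
Fact padic_mulDl : left_distributive padic_mul padic_add.
Proof.
by move=> x y z; apply: padic_ext => n /=; rewrite modnMml modnDm mulnDl.
Qed.
Fact padic_1neq0 : padic_nat 1 != padic_nat 0.
Proof.
apply/eqP => /(congr1 (fun x => padic_mod x 1)) /=.
by rewrite expn1 mod0n modn_small // prime_gt1.
Qed.

HB.instance Definition _ := GRing.isZmodule.Build Zp
  padic_addA padic_addC padic_add0 padic_addN.
HB.instance Definition _ := GRing.Zmodule_isComNzRing.Build Zp
  padic_mulA padic_mulC padic_mul1 padic_mulDl padic_1neq0.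

Definition padic_unit : pred Zp := fun x => `[< exists y, y * x = 1 >].
Definition padic_inv x : Zp :=
  if pselect (exists y, y * x = 1) is left ex then sval (cid ex) else x.

Fact padic_mulVx : {in padic_unit, left_inverse 1 padic_inv *%R}.
Proof.
move=> x /asboolP xU; rewrite /padic_inv.
by case: pselect => [ex|/(_ xU)//]; exact: (svalP (cid ex)).
Qed.
Fact padic_unitP x y : y * x = 1 -> padic_unit x.
Proof. by move=> yx1; apply/asboolP; exists y. Qed.
Fact padic_inv_out : {in [predC padic_unit], padic_inv =1 id}.
Proof.
move=> x /asboolP xNU; rewrite /padic_inv.
by case: pselect.
Qed.

HB.instance Definition _ := GRing.ComNzRing_hasMulInverse.Build Zp
  padic_mulVx padic_unitP padic_inv_out.

Fact padic_integral x y : x * y = 0 -> (x == 0) || (y == 0).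
Proof.
move=> xy0; apply: contrapT => /negP; rewrite negb_or => /andP[x0 y0].
have ex z : z != 0 -> exists n, ~~ (p ^ n %| padic_mod z n)%N.
  move=> /eqP z0; apply: contrapT => /forallNP zP; apply: z0.
  apply: padic_ext => n /=; rewrite mod0n.
  by have /negP := zP n; rewrite negbK => /eqP; rewrite padic_mod_modn.
have [m xm] := ex x x0; have [n yn] := ex y y0.
have := congr1 (fun z => padic_mod z (m + n)) xy0 => /=.
rewrite mod0n => /eqP; rewrite -/(dvdn _ _).
move: xm yn; rewrite (padic_mod_le x (leq_addr n m)).
rewrite (padic_mod_le y (leq_addl m n)) /dvdn !modn_mod -!/(dvdn _ _).
set u := padic_mod x _; set v := padic_mod y _ => um vn uv.
have u0 : (0 < u)%N by case: (u) um => //; rewrite dvdn0.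
have v0 : (0 < v)%N by case: (v) vn => //; rewrite dvdn0.
move: um vn uv; rewrite !pfactor_dvdn ?muln_gt0 ?u0 //.
by rewrite lognM // -!ltnNge => um vn; rewrite leqNgt -addSn leq_add // ltnW.
Qed.

HB.instance Definition _ :=
  GRing.ComUnitRing_isIntegral.Build Zp padic_integral.

(* The p-adic topology, i.e. the inverse limit topology. *)
HB.instance Definition _ := Topological.copy Zp
  (initial_topology (@padic_mod p p_pr : Zp -> {ptws nat -> nat})).

End PadicInt.

Definition padic (p : nat) (p_pr : prime p) : Type := {fraction padic_int p_pr}.
HB.instance Definition _ (p : nat) (p_pr : prime p) :=
  GRing.Field.on (padic p_pr).

Section MoritaGamma.
Variables (p : nat) (p_pr : prime p).

Definition morita_gamma_nat (n : nat) : padic_int p_pr :=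
  (-1) ^+ n * \prod_(1 <= j < n | ~~ (p %| j)%N) j%:R.

Definition morita_gamma : padic_int p_pr -> padic_int p_pr :=
  xget (fun=> 1) [set G : padic_int p_pr -> padic_int p_pr |
    [/\ continuous G, G 0 = 1 & forall n : nat, (0 < n)%N -> G n%:R = morita_gamma_nat n]].

Definition padic_integral_rat (x : rat) : Prop :=
  exists z : padic_int p_pr, tofrac z = ratr x.

End MoritaGamma.

Section Unramified.
Variables (p : nat) (p_pr : prime p) (L : fieldExtType (padic p_pr)).

Definition padic_in (z : padic_int p_pr) : L := (tofrac z : padic p_pr)%:A.

Definition integral_elt (x : L) : Prop := integralOver padic_in x.

(* [res], restricted to the ring of integers of L, is the reduction map onto  *)
(* the residue field F, and p generates its kernel, the maximal ideal: L is   *)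
(* unramified over Q_p. The values of [res] outside of the ring of integers   *)
(* are irrelevant.                                                            *)
Record unramified_residue (F : finFieldType) (res : L -> F) : Prop := {
  residue1 : res 1 = 1;
  residueD : forall x y, integral_elt x -> integral_elt y ->
    res (x + y) = res x + res y;
  residueM : forall x y, integral_elt x -> integral_elt y ->
    res (x * y) = res x * res y;
  residue_surj : forall c : F, exists2 x, integral_elt x & res x = c;
  residue_ker : forall x, integral_elt x ->
    (res x = 0 <-> exists2 y, integral_elt y & x = p%:R * y) }.

Variables (F : finFieldType) (res : L -> F).

Definition teichmuller (c : F) : L :=
  xget 0 [set x | [/\ integral_elt x, x ^+ #|F|.-1 = 1 & res x = c]].

(* The j-th power of the inverse of the Teichmuller character; it vanishes    *)
(* at 0 also when j = 0.                                                      *)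
Definition teichmuller_bar (j : nat) (c : F) : L :=
  if c == 0 then 0 else (teichmuller c)^-1 ^+ j.

Definition frac_part (x : rat) : rat := x - (Num.floor x)%:~R.

Definition gamma_rat (x : rat) : L := padic_in (morita_gamma (ratr x)).

(* mGm [a; b | lambda]_q with q = p ^ r *)
Definition mGm (r m : nat) (a b : 'I_m -> rat) (lambda : F) : L :=
  let q := (p ^ r)%N in
  -1 / q.-1%:R *
  \sum_(0 <= j < q.-1)
    (-1) ^+ (j * m) * teichmuller_bar j lambda *
    \prod_(i < m) \prod_(0 <= k < r)
      (gamma_rat (frac_part ((a i - j%:R / q.-1%:R) * p%:R ^+ k)) /
       gamma_rat (frac_part (a i * p%:R ^+ k)) *
       (gamma_rat (frac_part ((- b i + j%:R / q.-1%:R) * p%:R ^+ k)) /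
        gamma_rat (frac_part (- b i * p%:R ^+ k))) *
       (- p%:R) ^
         (- Num.floor (frac_part (a i * p%:R ^+ k)
                       - j%:R * p%:R ^+ k / q.-1%:R)
          - Num.floor (frac_part (- b i * p%:R ^+ k)
                       + j%:R * p%:R ^+ k / q.-1%:R))).

End Unramified.

Section DefinedOverQ.
Variable R : realType.
Local Notation C := R[i].

(* exp(2 pi i x) *)
Definition cexp (x : rat) : C :=
  Complex (cos (2 * pi * ratr x)) (sin (2 * pi * ratr x)).

Definition xn_sub1_prod (ns : seq nat) : {poly C} :=
  \prod_(n <- ns) ('X^n - 1).

Definition exponents_of (m : nat) (a b : 'I_m -> rat) (ps qs : seq nat) : Prop :=
  [/\ all (leq 1) ps, all (leq 1) qs &
   \prod_(i < m) (tofrac ('X - (cexp (a i))%:P) / tofrac ('X - (cexp (b i))%:P))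
   = tofrac (xn_sub1_prod ps) / tofrac (xn_sub1_prod qs) :> {fraction {poly C}}].

Definition defined_over_rat (m : nat) (a b : 'I_m -> rat) (ps qs : seq nat) :
    Prop :=
  exponents_of a b ps qs /\
  forall ps' qs', exponents_of a b ps' qs' ->
    (size ps <= size ps')%N /\ (size qs <= size qs')%N.

Definition common_poly (ps qs : seq nat) : {poly C} :=
  gcdp (xn_sub1_prod ps) (xn_sub1_prod qs).

Definition common_degree (ps qs : seq nat) : nat :=
  (size (common_poly ps qs)).-1.

(* multiplicity of exp(2 pi i c / (q - 1)) as a zero of the gcd *)
Definition common_mult (ps qs : seq nat) (q c : nat) : nat :=
  mup (cexp (c%:R / q.-1%:R)) (common_poly ps qs).

End DefinedOverQ.

Definition exponent_const (ps qs : seq nat) : rat :=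
  (\prod_(n <- ps) n%:R ^+ n) / (\prod_(n <- qs) n%:R ^+ n).

(* Main.v *)
Require Import Defs.
From HB Require Import structures.
From mathcomp Require Import all_boot all_order all_algebra all_field.
From mathcomp Require Import all_classical all_reals all_analysis.
From mathcomp Require Import complex cyclic zify ring lra.

Set Implicit Arguments.
Unset Strict Implicit.
Unset Printing Implicit Defensive.

Import Order.TTheory GRing.Theory Num.Theory.
Local Open Scope ring_scope.

(* Put t = j / (q - 1). Being defined over Q means that, modulo 1, the a_i     *)
(* together with a multiset S are all the h / p_i, and the b_i together with   *)
(* the same S all the h / q_i; S lists the zeros of D(x). So the j-th summand  *)
(* of mGm is a product over all the h / p_i and h / q_i, divided by a product  *)
(* over S. A full block {h / n : h < n} is evaluated by the multiplication     *)
(* formula for the p-adic gamma function; along the orbit x -> <p x> its       *)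
(* correction factors combine into a power of the Teichmuller lift of n. The   *)
(* factor at x in S is computed by the reflection formula; its sign is found   *)
(* from a telescoping sum of floors and from the invariance of S under         *)
(* multiplication by p. Minimality of the exponents forces them to be prime    *)
(* to p.                                                                       *)

(** * The p-adic integers *)

(** Fix j, put t = j / (q - 1), and write the j-th summand as a product of factors [hyp_term], one
    for each a_i (with shift - t), each b_i (with shift t) and each k. [common_fracs] supplies the
    multiset S that completes the a_i to the zeros of the product of the x^p_i - 1, and the b_i to
    those of the product of the x^q_i - 1. Multiplying the summand by the factors at S, taken with
    both shifts, turns it into a product over complete blocks h / n.

    Two evaluations then give the result. On a complete block, Gauss multiplication
    ([gauss_multiplication_cycle], [gamma_term_multiplication]) leaves the factor at n t or - n t
    and a power of the Teichmuller lift of n. Over all n these powers assemble into what relates the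
    characters at lambda and at M lambda ([teichmuller_barM]). On S, reflection ([hyp_term_common])
    leaves (-1)^(j delta) q^(s(0) - s(j)), and dividing by it gives the sign and the power of q of
    the formula. [cancel_common] combines the two.

    Both p-adic formulas are proved at natural numbers, by induction from the functional equation
    [morita_gammaS], and carried to Z_p by the congruences [padic_red_gamma]. Applying them to the
    blocks requires exponents prime to p, which is [exponents_coprime]. *)

Section PadicTopology.
Local Open Scope classical_set_scope.
Variables (p : nat) (p_pr : prime p).
Local Notation Zp := (padic_int p_pr).
Implicit Types x y : Zp.

Lemma padic_mod_eq_le x y m n : (m <= n)%N ->
  padic_mod x n = padic_mod y n -> padic_mod x m = padic_mod y m.
Proof. by move=> mn xy; rewrite !(padic_mod_le _ mn) xy. Qed.

(** A basic neighbourhood for the pointwise topology fixes finitely many residues, and the one of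
    largest index determines the others. *)
Lemma nbhs_padicP x (B : set Zp) :
  nbhs x B <-> exists M, forall y, padic_mod y M = padic_mod x M -> B y.
Proof.
split=> [|[M MB]].
  (* The sets containing all residue sequences of some ball around x. This filter converges
     pointwise to the sequence of x, each coordinate being constant on a small ball. *)
  pose F : set_system (nat -> nat) := [set A | exists M,
    forall y, padic_mod y M = padic_mod x M -> A (padic_mod y)].
  have FF : Filter F.
    split; first by exists 0%N.
      move=> P Q [M PM] [N QN]; exists (maxn M N) => y yx; split.
        by apply: PM; apply: padic_mod_eq_le yx; exact: leq_maxl.
      by apply: QN; apply: padic_mod_eq_le yx; exact: leq_maxr.
    by move=> P Q PQ [M PM]; exists M => y /PM /PQ.
  have Fx : {ptws, F --> padic_mod x}.
    apply/pointwise_cvgP => t A /= /nbhs_singleton At.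
    by exists t => y /= ->.
  rewrite nbhsE => -[_ [[C oC <-] Cx CB]].
  have : nbhs (padic_mod x : {ptws nat -> nat}) C by rewrite nbhsE; exists C.
  by move/Fx => [M MC]; exists M => y /MC /CB.
have cproj t : continuous (fun z : Zp => padic_mod z t).
  move=> z; apply: (@continuous_comp _ _ _ (@padic_mod p p_pr : Zp -> {ptws nat -> nat}) (fun h => h t)).
    exact: (@initial_continuous _ {ptws nat -> nat} (@padic_mod p p_pr)).
  exact: (@proj_continuous _ (fun=> nat) t).
have : nbhs x [set y | padic_mod y M = padic_mod x M].
  by apply: (cproj M x [set padic_mod x M]); exact: discrete_set1.
by apply: filterS => y; exact: MB.
Qed.

Lemma padic_continuousP (f : Zp -> Zp) :
  continuous f <-> forall x L, exists M, forall y,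
    padic_mod y M = padic_mod x M -> padic_mod (f y) L = padic_mod (f x) L.
Proof.
split=> [cf x L|fP x B].
  have /cf : nbhs (f x) [set z | padic_mod z L = padic_mod (f x) L].
    by apply/nbhs_padicP; exists L.
  by move/nbhs_padicP.
move=> /nbhs_padicP[L LB]; have [M Mf] := fP x L.
by apply/nbhs_padicP; exists M => y /Mf /LB.
Qed.

End PadicTopology.

(** * Reduction modulo powers of p *)

Section PadicReduction.
Variables (p : nat) (p_pr : prime p).
Local Notation Zp := (padic_int p_pr).
Implicit Types x y : Zp.

Lemma padic_modD x y n :
  padic_mod (x + y) n = ((padic_mod x n + padic_mod y n) %% p ^ n)%N.
Proof. by []. Qed.

Lemma padic_modM x y n :
  padic_mod (x * y) n = ((padic_mod x n * padic_mod y n) %% p ^ n)%N.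
Proof. by []. Qed.

(** The exponent is [L.+1] because ['Z_1] is Z/2 and not the zero ring; reduction modulo p is
    [padic_red 0]. *)
Definition padic_red (L : nat) (x : Zp) : 'Z_(p ^ L.+1) :=
  (padic_mod x L.+1)%:R.

Let pL_gt1 L : (1 < p ^ L.+1)%N.
Proof. by rewrite -(exp1n L.+1) ltn_exp2r // prime_gt1. Qed.

Lemma eq_Zp_nat L a b :
  (a%:R == b%:R :> 'Z_(p ^ L.+1)) = (a == b %[mod p ^ L.+1])%N.
Proof. by rewrite -(inj_eq val_inj) /= !val_Zp_nat. Qed.

Fact padic_red_is_zmod L : zmod_morphism (padic_red L).
Proof.
move=> x y; rewrite /padic_red; apply/eqP; rewrite eq_sym subr_eq -natrD.
by rewrite eq_Zp_nat -{1}(subrK y x) padic_modD modn_mod.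
Qed.

Fact padic_red_is_monoid L : monoid_morphism (padic_red L).
Proof.
split=> [|x y]; rewrite /padic_red; apply/eqP.
  by rewrite (eq_Zp_nat L _ 1) modn_mod.
by rewrite -natrM eq_Zp_nat padic_modM modn_mod.
Qed.

HB.instance Definition _ L :=
  GRing.isZmodMorphism.Build Zp 'Z_(p ^ L.+1) (padic_red L) (padic_red_is_zmod L).
HB.instance Definition _ L :=
  GRing.isMonoidMorphism.Build Zp 'Z_(p ^ L.+1) (padic_red L)
    (padic_red_is_monoid L).

Lemma padic_red_eqE L x y :
  (padic_red L x == padic_red L y) = (padic_mod x L.+1 == padic_mod y L.+1).
Proof. by rewrite eq_Zp_nat !padic_mod_modn. Qed.

Lemma padic_red_eqW L M x y : (L <= M)%N ->
  padic_red M x = padic_red M y -> padic_red L x = padic_red L y.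
Proof.
move=> LM /eqP; rewrite padic_red_eqE => /eqP xy; apply/eqP.
by rewrite padic_red_eqE; apply/eqP/(padic_mod_eq_le _ xy).
Qed.

Lemma padic_red_inj x y : (forall L, padic_red L x = padic_red L y) -> x = y.
Proof.
move=> xy; apply: padic_ext => -[|L].
  by rewrite -(padic_mod_modn x) -(padic_mod_modn y) expn0 !modn1.
by apply/eqP; rewrite -padic_red_eqE xy.
Qed.

Lemma padic_red_surj L x : exists2 X, (0 < X)%N & padic_red L x = padic_red L X%:R.
Proof.
exists (padic_mod x L.+1 + p ^ L.+1)%N.
  by rewrite addn_gt0 expn_gt0 (prime_gt0 p_pr) orbT.
rewrite rmorph_nat /padic_red; apply/eqP; rewrite eq_Zp_nat.
by rewrite modnDr.
Qed.

Lemma padic_red_nat_eq L a b : (a == b %[mod p ^ L.+1])%N ->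
  padic_red L a%:R = padic_red L b%:R.
Proof. by rewrite -eq_Zp_nat !rmorph_nat => /eqP. Qed.

Lemma padic_red_nat L n : padic_red L (n%:R : Zp) = n%:R.
Proof. exact: rmorph_nat. Qed.

Lemma padic_natr_neq0 n : (0 < n)%N -> n%:R != 0 :> Zp.
Proof.
move=> n0; apply/eqP => /(congr1 (padic_red n)); rewrite rmorph_nat rmorph0.
move/eqP; rewrite (eq_Zp_nat _ _ 0) mod0n -/(dvdn _ _) => /dvdn_leq => /(_ n0).
by apply/negP; rewrite -ltnNge (leq_trans (ltn_expl n (prime_gt1 p_pr))) // leq_exp2l // prime_gt1.
Qed.

(** A residue prime to p is invertible modulo each power of p; inverses are unique, so they are
    compatible and define a p-adic integer. *)
Lemma padic_unitE x : (x \is a GRing.unit) = (padic_mod x 1 != 0%N).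
Proof.
apply/idP/idP => [xU|x0].
  have /(congr1 (padic_red 0)) := divrr xU; rewrite rmorphM rmorph1 => /eqP.
  apply: contraTneq => /= x0.
  have /= -> : padic_red 0 x = 0 by rewrite /padic_red x0.
  by rewrite mul0r (eq_Zp_nat 0 0 1) mod0n modn_small.
have cop L : coprime (p ^ L.+1) (padic_mod x L.+1).
  rewrite coprime_pexpl // prime_coprime //; apply: contra x0 => px.
  by rewrite (padic_mod_le x (ltn0Sn L)).
have redU L : padic_red L x \is a GRing.unit by rewrite /padic_red unitZpE.
pose f L : nat := if L is L'.+1 then ((padic_red L' x)^-1 : 'Z_(p ^ L'.+1)) : nat else 0%N.
have fP L : (padic_mod x L.+1 * f L.+1 = 1 %[mod p ^ L.+1])%N.
  apply/eqP; rewrite -(eq_Zp_nat L) natrM /= natr_Zp -/(padic_red L x).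
  by rewrite mulrV // redU.
have fC L : (f L.+1 = f L %[mod p ^ L])%N.
  case: L => [|L]; first by rewrite expn0 !modn1.
  apply/eqP; rewrite -(eq_Zp_nat L); apply/eqP; apply: (mulrI (redU L)).
  rewrite /padic_red -!natrM; apply/eqP; rewrite eq_Zp_nat fP.
  rewrite (padic_mod_le x (leqnSn L.+1)) modnMml.
  by rewrite -(modn_dvdm (m := p ^ L.+2)) ?dvdn_exp2l // fP modn_dvdm // dvdn_exp2l.
apply/unitrPr; exists (padic_of p_pr fC); apply: padic_red_inj => L.
rewrite rmorphM rmorph1 /padic_red -natrM; apply/eqP; rewrite (eq_Zp_nat L _ 1).
by rewrite [padic_mod (padic_of _ _) _]/= modnMmr fP.
Qed.

Lemma padic_nat_unit n : (n%:R : Zp) \is a GRing.unit = ~~ (p %| n)%N.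
Proof.
rewrite padic_unitE; suff -> : padic_mod (n%:R : Zp) 1 = (n %% p)%N by [].
have /eqP := rmorph_nat (padic_red 0) n; rewrite /padic_red eq_Zp_nat padic_mod_modn.
by rewrite expn1 => /eqP.
Qed.

Lemma padic_red_unit L x : x \isn't a GRing.unit -> padic_red L x \isn't a GRing.unit.
Proof.
rewrite padic_unitE negbK /padic_red unitZpE // coprime_pexpl // prime_coprime //.
by rewrite negbK (padic_mod_le x (ltn0Sn L)) expn1.
Qed.

End PadicReduction.

(** * Existence and congruences of the p-adic gamma function *)

Section MoritaGammaTheory.
Local Open Scope classical_set_scope.
Variables (p : nat) (p_pr : prime p) (p_odd : odd p).
Local Notation Zp := (padic_int p_pr).
Local Notation gnat := (morita_gamma_nat p_pr).
Local Notation Gamma := (@morita_gamma p p_pr).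
Implicit Types x y : Zp.

Let p_gt2 : (2 < p)%N.
Proof. by case: p p_odd (prime_gt1 p_pr) => [|[|[|]]]. Qed.

(** Each block of p consecutive integers contributes (p - 1)!, which is -1 by Wilson's theorem. *)
Lemma prod_prime_to_modp M :
  (\prod_(0 <= j < M * p | ~~ (p %| j)%N) j%:R = (-1) ^+ M :> 'F_p).
Proof.
elim: M => [|M IH]; first by rewrite big_geq.
rewrite mulSn addnC (big_cat_nat _ (n := (M * p)%N)) ?leq_addr //= IH exprSr.
congr (_ * _); rewrite -{1}[(M * p)%N]add0n big_addn addKn.
rewrite (eq_big (fun j => ~~ (p %| j)%N) (fun j => j%:R)); first last.
- by move=> j _; rewrite natrD natrM pchar_Fp_0 // mulr0 addr0.
- by move=> j; rewrite dvdn_addl // dvdn_mull.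
rewrite big_ltn_cond ?prime_gt0 // dvdn0 /=.
have -> : \prod_(1 <= j < p | ~~ (p %| j)%N) (j%:R : 'F_p) = (p.-1)`!%:R.
  rewrite fact_prod natr_prod (prednK (prime_gt0 p_pr)) big_nat_cond [RHS]big_nat_cond.
  apply: eq_bigl => j; rewrite andbT; case: (boolP (0 < j < p)%N) => //= /andP[j0 jp].
  by rewrite gtnNdvd.
have := Wilson (prime_gt1 p_pr); rewrite p_pr => /esym.
by rewrite (dvdn_pcharf (pchar_Fp p_pr)) -[_`!.+1]addn1 natrD addr_eq0 => /eqP.
Qed.

(* The product A is its own inverse, so p^L divides (A - 1)(A + 1); by Wilson  *)
(* modulo p the first factor is prime to p.                                    *)
Lemma Wilson_pexp L :
  (\prod_(0 <= j < p ^ L.+1 | ~~ (p %| j)%N) j%:R = -1 :> 'Z_(p ^ L.+1)).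
Proof.
set n := (p ^ L.+1)%N.
have n1 : (1 < n)%N by rewrite -(exp1n L.+1) ltn_exp2r // prime_gt1.
set A := (\prod_(0 <= j < n | ~~ (p %| j)%N) j)%N.
have AE (R : pzSemiRingType) : \prod_(0 <= j < n | ~~ (p %| j)%N) j%:R = A%:R :> R.
  by rewrite natr_prod.
have A0 : (0 < A)%N by rewrite prodn_cond_gt0 // => -[|j] //; rewrite dvdn0.
have pA : (p %| A.+1)%N.
  rewrite (dvdn_pcharf (pchar_Fp p_pr)) -[A.+1]addn1 natrD addr_eq0 -AE /n expnSr.
  by rewrite prod_prime_to_modp -signr_odd oddX p_odd orbT.
have A2 : A%:R ^+ 2 = 1 :> 'Z_n.
  have -> : A%:R = \prod_(x : 'Z_n | x \is a GRing.unit) x :> 'Z_n.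
    have cast k : k = n -> \prod_(0 <= j < n | ~~ (p %| j)%N) j%:R =
        \prod_(0 <= j < k | ~~ (p %| j)%N) j%:R :> 'Z_n by move->.
    rewrite -AE (cast _ (Zp_cast n1)) big_mkord.
    apply: eq_big => [x|x _]; last by rewrite natr_Zp.
    by rewrite -[x in RHS]natr_Zp unitZpE // coprime_pexpl // prime_coprime.
  rewrite expr2 {1}(reindex_inj invr_inj) /= (eq_bigl (fun x : 'Z_n => x \is a GRing.unit)).
    by rewrite -big_split /= big1 // => x xU; rewrite mulVr.
  by move=> x; rewrite unitrV.
apply/eqP; rewrite AE -addr_eq0 -(natrD _ _ 1) [(A + 1)%N]addn1 (eq_Zp_nat p_pr L _ 0) mod0n -/(dvdn _ _).
have : (n %| A.-1 * A.+1)%N.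
  have -> : (A.-1 * A.+1 = A ^ 2 - 1)%N by case: (A) A0 => //= k _; lia.
  rewrite -eqn_mod_dvd ?expn_gt0 ?A0 // -(eq_Zp_nat p_pr L) natrX A2.
  by rewrite eqxx.
rewrite Gauss_dvdr // coprime_pexpl // prime_coprime //.
apply/negP => pA'; have : (p %| 2)%N.
  have -> : 2%N = (A.+1 - A.-1)%N by case: (A) A0 => //= k _; lia.
  exact: dvdn_sub.
by move/(dvdn_leq (ltn0Sn 1)); rewrite leqNgt p_gt2.
Qed.

(** The quotient of Gamma_p(x + 1) by Gamma_p(x); see [morita_gammaS]. *)
Definition morita_factor x : Zp := if x \is a GRing.unit then - x else -1.

Lemma morita_gamma_natE n : gnat n = \prod_(i < n) morita_factor i%:R.
Proof.
rewrite /morita_gamma_nat; elim: n => [|n IH].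
  by rewrite big_ord0 big_geq // expr0 mulr1.
rewrite big_ord_recr /= -{}IH /morita_factor padic_nat_unit.
case: n => [|n]; first by rewrite dvdn0 /= !big_geq // !mulr1 expr0 mul1r.
rewrite big_mkcond big_nat_recr //= -big_mkcond exprS.
by case: ifP => _; rewrite ?mulr1; [rewrite mulrN mulN1r !mulNr mulrA | rewrite mulN1r mulrN1 mulNr].
Qed.

Lemma padic_red_factor L x y : padic_red L x = padic_red L y ->
  padic_red L (morita_factor x) = padic_red L (morita_factor y).
Proof.
move=> xy; rewrite /morita_factor !padic_unitE.
have /eqP := xy; rewrite padic_red_eqE => /eqP /(padic_mod_eq_le (ltn0Sn L)) ->.
by case: ifP => // _; rewrite !rmorphN /= xy.
Qed.

(** A full period of p^(L+1) factors has product 1: the signs give -1, p being odd, and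
    [Wilson_pexp] gives another -1. *)
Lemma padic_red_gamma_nat L a b : (a == b %[mod p ^ L.+1])%N ->
  padic_red L (gnat a) = padic_red L (gnat b).
Proof.
set n := (p ^ L.+1)%N; rewrite !(morita_gamma_natE, rmorph_prod) /=.
have per c : (c = c %% n %[mod n])%N by rewrite modn_mod.
suff perG c k : \prod_(i < k * n + c) padic_red L (morita_factor i%:R) =
              \prod_(i < c) padic_red L (morita_factor i%:R).
  by move=> /eqP ab; rewrite (divn_eq a n) (divn_eq b n) !perG ab.
elim: k => [|k <-]; first by rewrite mul0n add0n.
rewrite mulSn -addnA big_split_ord /= [X in X * _](_ : _ = 1) ?mul1r.
  apply: eq_bigr => i _; apply/padic_red_factor/padic_red_nat_eq.
  by rewrite modnDl.
rewrite -(big_mkord xpredT (fun i => padic_red L (morita_factor i%:R))).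
under eq_bigr => i _.
  have -> : padic_red L (morita_factor i%:R) =
      - (if ~~ (p %| i)%N then i%:R else 1).
    rewrite /morita_factor padic_nat_unit.
    by case: ifP => _; rewrite rmorphN ?rmorph1 ?rmorph_nat.
  over.
rewrite (eq_bigr (fun i => -1 * (if ~~ (p %| i)%N then i%:R else 1))); last first.
  by move=> i _; rewrite mulN1r.
rewrite big_split /= -big_mkcond Wilson_pexp prodr_const_nat subn0.
by rewrite -signr_odd oddX p_odd orbT mulrNN mulr1.
Qed.

Fact morita_gamma_subproof x L :
  (padic_mod (gnat (padic_mod x L.+1)) L.+1 =
   padic_mod (gnat (padic_mod x L)) L %[mod p ^ L])%N.
Proof.
case: L => [|L]; first by rewrite expn0 !modn1.
rewrite (padic_mod_modn _ L.+1) -padic_modP; apply/eqP.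
rewrite -padic_red_eqE; apply/eqP/padic_red_gamma_nat.
by rewrite padic_mod_modn -padic_modP.
Qed.

(** [xget] returns a function with these properties as soon as one exists. The witness takes, modulo
    p^L, the residue of the product at the natural number [padic_mod x L]; periodicity makes these
    residues compatible. *)
Lemma morita_gammaP :
  [/\ continuous Gamma, Gamma 0 = 1 & forall n, (0 < n)%N -> Gamma n%:R = gnat n].
Proof.
rewrite /morita_gamma; case: xgetP => [G _ []//|/(_ (fun x => padic_of p_pr (morita_gamma_subproof x)))].
have ofE x L : padic_mod (padic_of p_pr (morita_gamma_subproof x)) L.+1 =
    padic_mod (gnat (padic_mod x L.+1)) L.+1 by exact: padic_mod_modn.
case; split.
- apply/padic_continuousP => x L; exists L => y yx /=.
  by rewrite yx.
- have -> : 1 = gnat 0 by rewrite morita_gamma_natE big_ord0.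
  apply: padic_red_inj => L; apply/eqP; rewrite padic_red_eqE ofE.
  by rewrite [padic_mod 0 _]mod0n.
- move=> n _; apply: padic_red_inj => L; apply/eqP; rewrite padic_red_eqE ofE.
  rewrite -padic_red_eqE; apply/eqP/padic_red_gamma_nat.
  by have /eqP := padic_red_nat p_pr L n; rewrite eq_Zp_nat.
Qed.

Lemma morita_gamma_nat_eq n : Gamma n%:R = gnat n.
Proof.
have [_ G0 Gn] := morita_gammaP; case: n => [|n]; last exact: Gn.
by rewrite morita_gamma_natE big_ord0.
Qed.

(** Continuity gives a modulus M depending on the point. A natural number N close to z both to depth
    M and to depth L reduces the claim to natural numbers, where periodicity supplies the uniform
    modulus p^(L+1). *)
Lemma padic_red_gamma L x y : padic_red L x = padic_red L y ->
  padic_red L (Gamma x) = padic_red L (Gamma y).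
Proof.
have [/padic_continuousP cG _ _] := morita_gammaP.
suff GE (z : Zp) n : padic_red L z = padic_red L (n%:R : Zp) -> padic_red L (Gamma z) = padic_red L (gnat n).
  have [n _ yn] := padic_red_surj L y.
  by move=> xy; rewrite (GE x n) ?(GE y n) // -yn.
move=> zn; have [M MG] := cG z L.+1; have [N _ zN] := padic_red_surj (maxn M L) z.
have zN' := padic_red_eqW (leq_maxr M L) zN.
transitivity (padic_red L (Gamma N%:R)).
  apply/eqP; rewrite padic_red_eqE; apply/eqP/esym/MG.
  apply: (@padic_mod_eq_le _ _ _ _ _ (maxn M L).+1).
    by rewrite (leq_trans (leq_maxl M L)).
  by apply/eqP; rewrite -padic_red_eqE zN.
rewrite morita_gamma_nat_eq; apply: padic_red_gamma_nat.
by rewrite -(eq_Zp_nat p_pr) -!(padic_red_nat p_pr) -zN' zn.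
Qed.

Lemma morita_gammaS x : Gamma (x + 1) = morita_factor x * Gamma x.
Proof.
apply: padic_red_inj => L; have [n _ xn] := padic_red_surj L x.
have xn1 : padic_red L (x + 1) = padic_red L (n.+1%:R : Zp).
  by rewrite rmorphD /= xn -[n.+1]addn1 natrD rmorphD.
rewrite rmorphM /= (padic_red_gamma xn) (padic_red_gamma xn1) (padic_red_factor xn) -rmorphM.
by rewrite !morita_gamma_nat_eq !morita_gamma_natE big_ord_recr /= mulrC.
Qed.

Lemma morita_gamma0 : Gamma 0 = 1.
Proof. by have [] := morita_gammaP. Qed.

End MoritaGammaTheory.

(** * Reflection and multiplication formulas *)

Section GaussReflection.
Variables (p : nat) (p_pr : prime p) (p_odd : odd p).
Local Notation Zp := (padic_int p_pr).
Local Notation Gamma := (@morita_gamma p p_pr).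
Implicit Types x y : Zp.

Lemma morita_factor_unit x : morita_factor x \is a GRing.unit.
Proof. by rewrite /morita_factor; case: ifP; rewrite ?unitrN ?unitr1. Qed.

Lemma morita_gamma_unit x : Gamma x \is a GRing.unit.
Proof.
have [n _ xn] := padic_red_surj 0 x.
apply: contraT => /(padic_red_unit 0); rewrite (padic_red_gamma p_odd xn).
rewrite morita_gamma_nat_eq // morita_gamma_natE rmorph_unit //.
by apply: rpred_prod => i _; exact: morita_factor_unit.
Qed.

(** The number of steps from 0 to X on which the unit branch of [morita_factor] applies: the
    exponent of -1 in reflection and of n in multiplication. *)
Definition prime_to_count (X : nat) : nat := (\sum_(i < X) ~~ (p %| i))%N.

Lemma prime_to_countS X : prime_to_count X.+1 = (prime_to_count X + ~~ (p %| X))%N.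
Proof. by rewrite /prime_to_count big_ord_recr. Qed.

(** The multiples of p below X number X / p rounded up, which is Y for X = p Y - d. *)
Lemma prime_to_countE Y d : (d < p)%N -> (d <= p * Y)%N ->
  (prime_to_count (p * Y - d) + Y = p * Y - d)%N.
Proof.
clear p_odd; have p0 := prime_gt0 p_pr.
have cnt X : (prime_to_count X + (X + p.-1) %/ p = X)%N.
  elim: X => [|X IH]; first by rewrite /prime_to_count big_ord0 divn_small // prednK.
  rewrite prime_to_countS addSn divnS // -addnS prednK // dvdn_addl //.
  by move: IH; case: (p %| X)%N => /=; lia.
move=> dp dY; have := cnt (p * Y - d)%N.
have -> : (p * Y - d + p.-1 = Y * p + (p.-1 - d))%N by lia.
by rewrite divnMDl // divn_small ?addn0 //; lia.
Qed.

(** From X to X + 1 the product changes by [morita_factor] at X over that at - X, which is -1 if p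
    does not divide X and 1 otherwise. *)
Lemma gamma_reflection_nat X :
  Gamma X%:R * Gamma (1 - X%:R) = - (-1) ^+ prime_to_count X.
Proof.
elim: X => [|X IH].
  rewrite /prime_to_count big_ord0 subr0 morita_gamma0 // mul1r.
  rewrite -{1}[1]add0r morita_gammaS // morita_gamma0 // mulr1 expr0.
  by rewrite /morita_factor unitr0.
rewrite -[X.+1]addn1 addn1 -{1}[X.+1]addn1 natrD morita_gammaS // prime_to_countS.
have -> : 1 - (X.+1)%:R = - X%:R :> Zp by rewrite -[X.+1]addn1 natrD opprD addrCA subrr addr0.
move: IH; rewrite [1 - _]addrC morita_gammaS // /morita_factor unitrN padic_nat_unit.
case: (p %| X)%N => /= IH; rewrite ?addn0 ?addn1.
  by rewrite -IH; ring.
by rewrite exprS mulN1r -IH; ring.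
Qed.

(** Here d is the residue of - x modulo p. For a natural number Y close to y the count is p Y - d -
    Y, of the parity of d because p is odd. *)
Lemma gamma_reflection x y d : (d < p)%N -> x = p%:R * y - d%:R ->
  Gamma x * Gamma (1 - x) = - (-1) ^+ d.
Proof.
move=> dp ->; apply: padic_red_inj => L; have [Y Y0 yY] := padic_red_surj L y.
have dY : (d <= p * Y)%N by rewrite (leq_trans (ltnW dp)) // leq_pmulr.
have xX : padic_red L (p%:R * y - d%:R) = padic_red L ((p * Y - d)%N%:R : Zp).
  by rewrite natrB // natrM !(rmorphB, rmorphM) /= yY.
have xX' : padic_red L (1 - (p%:R * y - d%:R)) = padic_red L (1 - (p * Y - d)%N%:R : Zp).
  by rewrite rmorphB /= xX -rmorphB.
rewrite rmorphM /= (padic_red_gamma p_odd xX) (padic_red_gamma p_odd xX') -rmorphM.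
rewrite gamma_reflection_nat; congr (padic_red L (- _)).
have := prime_to_countE dp dY; set c := prime_to_count _ => cE.
rewrite -signr_odd -[RHS]signr_odd; congr (_ ^+ (nat_of_bool _)).
have : odd (c + Y) = odd (p * Y - d) by rewrite cE.
by rewrite oddD oddB // oddM p_odd /=; case: (odd c) (odd Y) (odd d) => -[] [].
Qed.

Variable n : nat.
Hypothesis pn : ~~ (p %| n)%N.

Let n_gt0 : (0 < n)%N. Proof. by case: n pn; rewrite ?dvdn0. Qed.
Let nU : (n%:R : Zp) \is a GRing.unit. Proof. by rewrite padic_nat_unit. Qed.

Definition gamma_mul x := \prod_(h < n) Gamma ((x + h%:R) / n%:R).

(** Passing from X to X + 1 shifts the arguments by 1 / n, so only X / n is replaced, by X / n + 1.
    The new factor is [morita_factor] of X / n, which is that of X divided by n exactly when X is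
    prime to p. *)
Lemma gamma_mul_nat X :
  gamma_mul X%:R * n%:R ^+ prime_to_count X = gamma_mul 0 * Gamma X%:R.
Proof.
elim: X => [|X IH].
  by rewrite /prime_to_count big_ord0 morita_gamma0.
have step : gamma_mul X.+1%:R = gamma_mul X%:R * morita_factor (X%:R / n%:R).
  apply: (mulrI (morita_gamma_unit (X%:R / n%:R))).
  rewrite mulrCA [Gamma _ * morita_factor _]mulrC -morita_gammaS //.
  transitivity (\prod_(h < n.+1) Gamma ((X%:R + h%:R) / n%:R)).
    rewrite big_ord_recl addr0; congr (_ * _); apply: eq_bigr => i _.
    by rewrite lift0 -addn1 -[i.+1]addn1 !natrD addrA addrAC.
  by rewrite big_ord_recr /= mulrDl divrr.
rewrite step -[in RHS]addn1 natrD morita_gammaS // prime_to_countS exprD.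
rewrite mulrACA IH -mulrA; congr (_ * _); rewrite mulrC; congr (_ * _).
rewrite /morita_factor unitrMl ?unitrV // padic_nat_unit.
by case: (p %| X)%N => /=; rewrite ?mulr1 // expr1 mulNr divrK.
Qed.

Lemma padic_red_gamma_mul L x y : padic_red L x = padic_red L y ->
  padic_red L (gamma_mul x) = padic_red L (gamma_mul y).
Proof.
move=> xy; rewrite !rmorph_prod /=; apply: eq_bigr => h _.
by apply: padic_red_gamma => //; rewrite !(rmorphM, rmorphD) /= xy.
Qed.

Fact padic_teich_subproof L : (n ^ (p ^ L.+1) = n ^ (p ^ L) %[mod p ^ L])%N.
Proof.
case: L => [|L]; first by rewrite expn0 !modn1.
have -> : (p ^ L.+2 = totient (p ^ L.+1) * p + p ^ L.+1)%N.
  rewrite totient_pfactor //= -mulnA -expnSr -mulSnr prednK ?prime_gt0 //.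
rewrite expnD expnM -modnMml -modnXm Euler_exp_totient; last first.
  by rewrite coprime_sym coprime_pexpl // prime_coprime.
by rewrite modnXm exp1n modnMml mul1n.
Qed.

(** The Teichmuller lift of n in Z_p, as the limit of n^(p^L). *)
Definition padic_teich : Zp := padic_of p_pr padic_teich_subproof.

Lemma padic_red_teich L M : (L < M)%N ->
  padic_red L ((n%:R : Zp) ^+ (p ^ M)) = padic_red L padic_teich.
Proof.
move=> LM; have : padic_red M.-1 ((n%:R : Zp) ^+ (p ^ M)) = padic_red M.-1 padic_teich.
  case: M LM => // M _ /=; rewrite -natrX padic_red_nat /padic_red.
  by apply/eqP; rewrite (eq_Zp_nat p_pr) /padic_teich /= modn_mod.
by move=> h; apply: (padic_red_eqW _ h); case: M LM {h}.
Qed.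

Lemma padic_teich_exp : padic_teich ^+ p.-1 = 1.
Proof.
apply: padic_red_inj => L; rewrite rmorphXn /= -(padic_red_teich (ltnSn L)).
rewrite -rmorphXn /= -exprM -natrX padic_red_nat rmorph1; apply/eqP.
have -> : (p ^ L.+1 * p.-1 = totient (p ^ L.+1) * p)%N.
  by rewrite totient_pfactor //= expnSr mulnAC [(p ^ L * _)%N]mulnC.
rewrite (eq_Zp_nat p_pr L _ 1) expnM -modnXm Euler_exp_totient.
  by rewrite modnXm exp1n.
by rewrite coprime_sym coprime_pexpl // prime_coprime.
Qed.

Lemma padic_teich_res : padic_red 0 padic_teich = padic_red 0 (n%:R : Zp).
Proof.
rewrite -(padic_red_teich (ltnSn 0)) -natrX; apply: padic_red_nat_eq.
by rewrite !expn1 fermat_little.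
Qed.

End GaussReflection.

Lemma big_shift_cycle (T : Type) (idx : T) (op : Monoid.com_law idx) r
    (F : nat -> T) : F r = F 0%N ->
  \big[op/idx]_(k < r) F k.+1 = \big[op/idx]_(k < r) F k.
Proof.
case: r => [|r] Fr; first by rewrite !big_ord0.
by rewrite big_ord_recr big_ord_recl /= Fr Monoid.mulmC.
Qed.

Lemma dvdn_predn_exp p r : prime p -> (0 < r)%N -> ~~ (p %| (p ^ r).-1)%N.
Proof.
move=> p_pr r_gt0; apply/negP => pq1; have : (p %| p ^ r)%N by rewrite dvdn_exp.
rewrite -[(p ^ r)%N]prednK ?expn_gt0 ?prime_gt0 // -addn1 dvdn_addr // dvdn1.
by move=> /eqP p1; move: p_pr; rewrite p1.
Qed.

(** * Gauss multiplication along an orbit of multiplication by p *)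

Section GaussCycle.
Variables (p : nat) (p_pr : prime p) (p_odd : odd p).
Local Notation Zp := (padic_int p_pr).
Local Notation Gamma := (@morita_gamma p p_pr).
Variable n : nat.
Hypothesis pn : ~~ (p %| n)%N.
Variables (r : nat) (r_gt0 : (0 < r)%N) (c : nat).
Local Notation q := (p ^ r)%N.
Hypothesis c_lt : (c < q.-1)%N.
Local Notation u k := ((p ^ k * c) %% q.-1)%N.
Local Notation tau := (padic_teich p_pr pn).

Let p_gt0 : (0 < p)%N. Proof. exact: prime_gt0. Qed.
Let q1_gt0 : (0 < q.-1)%N. Proof. exact: leq_ltn_trans c_lt. Qed.
Let q1E : q = q.-1.+1.
Proof. by rewrite prednK // expn_gt0 p_gt0. Qed.
(** The base p digits of c / (q - 1), found by long division with remainders [u k]. *)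
Let d k := ((p * u k) %/ q.-1)%N.

Let uS k : (p * u k = u k.+1 + d k * q.-1)%N.
Proof. by rewrite [LHS](divn_eq _ q.-1) addnC /d modnMmr expnS mulnA. Qed.

Let d_lt k : (d k < p)%N.
Proof. by rewrite /d ltn_divLR // ltn_pmul2l // ltn_mod. Qed.

Let ur : u r = u 0.
Proof. by rewrite {1}q1E mulSn addnC [(_ * c)%N]mulnC modnMDl expn0 mul1n. Qed.

(** Since tau^p = tau, the place values of the digits do not matter in an exponent, and the first r
    digits form the number floor(q c / (q - 1)) = c. *)
Let tauD : tau ^+ (\sum_(k < r) d k) = tau ^+ c.
Proof.
have tp : tau ^+ p = tau.
  transitivity (tau ^+ p.-1.+1); first by rewrite prednK.
  by rewrite exprS padic_teich_exp mulr1.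
have DS m : tau ^+ (\sum_(k < m) d k) = tau ^+ ((p ^ m * c) %/ q.-1).
  elim: m => [|m IH].
    by rewrite big_ord0 expn0 mul1n divn_small.
  rewrite big_ord_recr /= exprD IH expnS -mulnA.
  rewrite [in RHS](divn_eq (p ^ m * c) q.-1) mulnDr mulnA divnMDl //.
  by rewrite exprD exprM tp.
by rewrite DS {1}q1E mulSn addnC [(q.-1 * c)%N]mulnC divnMDl // divn_small // addn0.
Qed.

Let Q s := (p ^ (r * s))%N.
Let R s := (\sum_(i < s) q ^ i)%N.
Let X s k := (Q s - u k * R s)%N.

Let QE s : Q s = (q.-1 * R s).+1.
Proof. by rewrite -predn_exp -expnM prednK // expn_gt0 p_gt0. Qed.

Let XE s k : (X s k + u k * R s = Q s)%N.
Proof.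
rewrite subnK // QE leqW // leq_mul2r orbC.
by rewrite ltnW // ltn_mod.
Qed.

Let XS s k : (p * X s k = X s k.+1 + (p.-1 - d k) * Q s + d k)%N.
Proof.
have := XE s k; have := XE s k.+1; have := uS k; have := QE s; have := d_lt k.
move: (Q s) (R s) (X s k) (X s k.+1) (u k) (u k.+1) (d k) => Qs Rs x y a b e.
move=> ep QR ab bX aX.
have ReQ : (e * q.-1 * Rs + e = e * Qs)%N by rewrite QR mulnS mulnA addnC.
have pX : (p * x + b * Rs + e * q.-1 * Rs = p * Qs)%N.
  by rewrite -addnA -mulnDl -ab -mulnA -mulnDr aX.
have pQ : ((p.-1 - e) * Qs + e * Qs + Qs = p * Qs)%N.
  by rewrite -mulnDl subnK -?mulSnr ?prednK // -ltnS prednK.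
lia.
Qed.

(** [X s k.+1] is p Y - d k for Y = X s k - (Q / p) (p - 1 - d k), so [prime_to_countE] gives the
    count X s k.+1 - Y. Around the cycle the terms in X cancel. *)
Let count_sum s : (0 < s)%N ->
  (\sum_(k < r) prime_to_count p (X s k.+1) =
   p ^ (r * s).-1 * \sum_(k < r) (p.-1 - d k))%N.
Proof.
move=> s0; set Q' := (p ^ (r * s).-1)%N.
have QQ' : Q s = (p * Q')%N by rewrite -expnS prednK // muln_gt0 r_gt0.
have cX k : (prime_to_count p (X s k.+1) + X s k = X s k.+1 + Q' * (p.-1 - d k))%N.
  have := XS s k; rewrite QQ' => XS'.
  have le : (Q' * (p.-1 - d k) <= X s k)%N.
    by rewrite -(leq_pmul2l p_gt0) XS'; lia.
  have YE : (p * (X s k - Q' * (p.-1 - d k)) - d k = X s k.+1)%N.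
    by rewrite mulnBr XS'; lia.
  have dle : (d k <= p * (X s k - Q' * (p.-1 - d k)))%N.
    by rewrite mulnBr XS'; lia.
  have := prime_to_countE p_pr (d_lt k) dle; rewrite YE => cE.
  by rewrite -[X in _ = (X + _)%N]cE -addnA subnK.
apply: (@addIn (\sum_(k < r) X s k)).
rewrite -big_split /= (eq_bigr (fun k : 'I_r => (X s k.+1 + Q' * (p.-1 - d k))%N)); last first.
  by move=> k _; exact: cX.
rewrite big_split /= -big_distrr /=.
rewrite addnC; congr addn; apply: (@big_shift_cycle _ _ addn _ (X s)).
by rewrite /X ur.
Qed.

Let red_X L s k : (L < r * s)%N ->
  padic_red L ((u k)%:R / q.-1%:R : Zp) = padic_red L ((X s k)%:R : Zp).
Proof.
move=> Ls; have q1U : (q.-1%:R : Zp) \is a GRing.unit.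
  by rewrite padic_nat_unit dvdn_predn_exp.
have Q0 : padic_red L ((Q s)%:R : Zp) = 0.
  by rewrite padic_red_nat; apply/eqP; rewrite (eq_Zp_nat p_pr L _ 0) mod0n -/(dvdn _ _) dvdn_exp2l.
have -> : (X s k)%:R = (u k)%:R / q.-1%:R + (Q s)%:R * (1 - (u k)%:R / q.-1%:R) :> Zp.
  apply: (mulIr q1U); set x := _ / _.
  have xq : x * q.-1%:R = (u k)%:R by rewrite divrK.
  have -> : (x + (Q s)%:R * (1 - x)) * q.-1%:R =
      x * q.-1%:R + (Q s)%:R * q.-1%:R - (Q s)%:R * (x * q.-1%:R) by ring.
  apply/eqP; rewrite xq -subr_eq opprK -!natrM -!natrD; apply/eqP; congr _%:R.
  rewrite -{2}(XE s k) mulnDl addnC.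
  have := QE s; have := XE s k; move: (u k) (Q s) (R s) (X s k) => a Qs Rs z az QR.
  by rewrite [in LHS]QR; ring.
by rewrite rmorphD [X in _ + X]rmorphM /= Q0 mul0r addr0.
Qed.

(* The u k / (q - 1) are the iterates of c / (q - 1) under x -> <p x>. With    *)
(* Q = q^s and R = (Q - 1) / (q - 1), the natural number X s k = Q - u k * R   *)
(* approximates u k / (q - 1) modulo Q, and p * X s k exceeds X s k.+1 by a    *)
(* multiple of Q plus the digit d k; this determines the number of factors n.  *)
Lemma gauss_multiplication_cycle :
  \prod_(k < r) gamma_mul n ((u k)%:R / q.-1%:R) =
  tau ^+ c * gamma_mul n 0 ^+ r * \prod_(k < r) Gamma ((u k)%:R / q.-1%:R).
Proof.
set E := (\sum_(k < r) (p.-1 - d k))%N.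
(* The p - 1 - d k complete the digit sum to r (p - 1), and tau^(p - 1) = 1. *)
have tauE : tau ^+ E * tau ^+ c = 1.
  rewrite -tauD -exprD -big_split /=.
  rewrite (eq_bigr (fun _ => p.-1)); last first.
    by move=> k _; rewrite subnK // -ltnS prednK.
  by rewrite sum_nat_const mulnC exprM padic_teich_exp expr1n.
suff H : (\prod_(k < r) gamma_mul n ((u k)%:R / q.-1%:R)) * tau ^+ E =
    gamma_mul n 0 ^+ r * \prod_(k < r) Gamma ((u k)%:R / q.-1%:R).
  by rewrite -mulrA -H mulrCA [tau ^+ c * _]mulrC tauE mulr1.
rewrite -(@big_shift_cycle _ _ *%R _ (fun k => gamma_mul n ((u k)%:R / q.-1%:R))) ?ur //.
rewrite -(@big_shift_cycle _ _ *%R _ (fun k => Gamma ((u k)%:R / q.-1%:R))) ?ur //.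
(* This s is large enough for Q to vanish modulo p^(L+1) and for n^(p^(r s - 1)) to reduce to tau
   there. *)
apply: padic_red_inj => L; set s := L.+2.
have Lrs : (L.+1 < r * s)%N by rewrite leq_pmull.
transitivity (padic_red L (\prod_(k < r) (gamma_mul n ((X s k.+1)%:R : Zp) * n%:R ^+ prime_to_count p (X s k.+1)))).
  rewrite big_split rmorphM [RHS]rmorphM /= prodrXr count_sum // exprM.
  rewrite [in RHS]rmorphXn /= padic_red_teich; last by rewrite -ltnS prednK // (leq_ltn_trans _ Lrs).
  rewrite -rmorphXn; congr (_ * _); rewrite !rmorph_prod /=; apply: eq_bigr => k _.
  by apply: padic_red_gamma_mul => //; apply: red_X; exact: ltnW.
rewrite (eq_bigr (fun k : 'I_r => gamma_mul n 0 * Gamma (X s k.+1)%:R)); last first.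
  by move=> k _; exact: gamma_mul_nat.
rewrite big_split rmorphM [RHS]rmorphM /= prodr_const card_ord; congr (_ * _).
rewrite !rmorph_prod /=; apply: eq_bigr => k _; symmetry.
by apply: padic_red_gamma => //; apply: red_X; exact: ltnW.
Qed.

End GaussCycle.

(** * Fractional parts and p-integral rationals *)

Section FracPart.
Implicit Types x y c : rat.

Lemma floorE x : (Num.floor x)%:~R = x - frac_part x.
Proof. by rewrite /frac_part subKr. Qed.

Lemma frac_part_ge0 x : 0 <= frac_part x.
Proof. by rewrite subr_ge0 floor_le. Qed.

Lemma frac_part_lt1 x : frac_part x < 1.
Proof. by rewrite ltrBlDl; have := floorD1_gt x; rewrite intrD. Qed.

Lemma frac_part_id x : 0 <= x < 1 -> frac_part x = x.
Proof. by move=> x01; rewrite /frac_part (@floor_def _ _ 0) ?subr0. Qed.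

Lemma frac_partDr x c : c \is a Num.int -> frac_part (x + c) = frac_part x.
Proof.
by move=> /intrP[z ->]; rewrite /frac_part floorDrz ?intr_int // intrKfloor intrD; ring.
Qed.

Lemma frac_partB_int x : x - frac_part x \is a Num.int.
Proof. by rewrite -floorE. Qed.

Lemma frac_part_congr x y : x - y \is a Num.int -> frac_part x = frac_part y.
Proof. by move=> /(frac_partDr y); rewrite addrC subrK. Qed.

Lemma frac_part_eq x y : (frac_part x == frac_part y) = (x - y \is a Num.int).
Proof.
apply/eqP/idP => [xy|/frac_part_congr//].
have -> : x - y = (x - frac_part x) - (y - frac_part y) by rewrite xy; ring.
by rewrite rpredB ?frac_partB_int.
Qed.

Lemma frac_part_eq0 x : (frac_part x == 0) = (x \is a Num.int).
Proof. by rewrite -[X in _ == X](frac_part_id (x := 0)) // frac_part_eq subr0. Qed.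

Lemma frac_partN x : x \isn't a Num.int -> frac_part (- x) = 1 - frac_part x.
Proof.
rewrite -frac_part_eq0 => x0; rewrite -[RHS]frac_part_id.
  apply: frac_part_congr; rewrite -[_ - _]opprK rpredN.
  have -> : - (- x - (1 - frac_part x)) = (x - frac_part x) + 1 by ring.
  by rewrite rpredD ?frac_partB_int.
rewrite subr_ge0 ltW ?frac_part_lt1 //= ltrBlDr ltrDl lt_neqAle eq_sym x0.
exact: frac_part_ge0.
Qed.

End FracPart.

(** The reduced denominator of x divides D, so it is a unit when D is. The ring need not contain the
    rationals: it will be Z_p and the finite field. *)
Lemma ratr_int_div (R : comUnitRingType) (x : rat) (D : nat) (c : int) :
  (D%:R : R) \is a GRing.unit -> x * D%:R = c%:~R -> (ratr x : R) = c%:~R / D%:R.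
Proof.
move=> DU xD.
have nE : numq x * D%:Z = c * denq x.
  apply: (@intr_inj rat); rewrite !intrM -xD.
  by rewrite -{2}[x]divq_num_den mulrAC divfK // intr_eq0 denq_neq0.
have /dvdnP[f Df] : (`|denq x| %| D)%N.
  have : (denq x %| numq x * D%:Z)%Z by rewrite nE dvdz_mull.
  by rewrite Gauss_dvdzr // coprimezE coprime_sym coprime_num_den.
have dU : ((denq x)%:~R : R) \is a GRing.unit.
  by move: DU; rewrite Df natrM unitrM -absz_denq => /andP[].
apply: (mulIr DU); apply: (mulIr dU); rewrite divrK // /ratr mulrAC divrK //.
by rewrite -[D%:R]/(D%:Z%:~R) -!intrM nE.
Qed.

Section PIntegral.
Variables (p : nat) (p_pr : prime p).
Local Notation Zp := (padic_int p_pr).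
Implicit Types x y : rat.

Definition p_integral x := exists2 D : nat, ~~ (p %| D)%N & x * D%:R \is a Num.int.

Lemma p_integral_int x : x \is a Num.int -> p_integral x.
Proof. by move=> xi; exists 1%N; rewrite ?mulr1 // dvdn1 gtn_eqF // prime_gt1. Qed.

Lemma p_integralD x y : p_integral x -> p_integral y -> p_integral (x + y).
Proof.
move=> [D pD xD] [E pE yE]; exists (D * E)%N; first by rewrite Euclid_dvdM // negb_or pD.
have -> : (x + y) * (D * E)%:R = (x * D%:R) * E%:R + (y * E%:R) * D%:R.
  by rewrite natrM; ring.
by apply: rpredD; apply: rpredM => //; exact: natr_int.
Qed.

Lemma p_integralM x y : p_integral x -> p_integral y -> p_integral (x * y).
Proof.
move=> [D pD xD] [E pE yE]; exists (D * E)%N; first by rewrite Euclid_dvdM // negb_or pD.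
by rewrite natrM mulrACA rpredM.
Qed.

Lemma p_integralN x : p_integral x -> p_integral (- x).
Proof. by move=> [D pD xD]; exists D; rewrite // mulNr rpredN. Qed.

Lemma p_integral_div (a n : nat) : ~~ (p %| n)%N -> p_integral (a%:R / n%:R).
Proof.
move=> pn; exists n => //; rewrite divfK ?natr_int // pnatr_eq0.
by apply: contraNneq pn => ->.
Qed.

Lemma p_integral_frac x : p_integral x -> p_integral (frac_part x).
Proof.
move=> xp; apply: p_integralD xp (p_integralN (p_integral_int _)).
exact: intr_int.
Qed.

Lemma p_integral_mulp x : p_integral x -> x * p%:R \is a Num.int -> x \is a Num.int.
Proof.
move=> [D pD /intrP[c xD]] /intrP[e xp].
have De : D%:Z * e = p%:Z * c.
  by apply: (@intr_inj rat); rewrite !intrM -xD -xp; ring.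
have : (p %| D%:Z * e)%Z by rewrite De dvdz_mulr.
rewrite Gauss_dvdzr ?coprimezE ?prime_coprime // => /dvdzP[f ef].
apply/intrP; exists f; move: xp; rewrite ef intrM => /mulIf; apply.
by rewrite pnatr_eq0 -lt0n prime_gt0.
Qed.

Lemma ratr_p_integral x (D : nat) (c : int) : ~~ (p %| D)%N ->
  x * D%:R = c%:~R -> (ratr x : Zp) = c%:~R / D%:R.
Proof. by move=> pD; apply: ratr_int_div; rewrite padic_nat_unit. Qed.

Lemma ratr_int (c : int) : (ratr c%:~R : Zp) = c%:~R.
Proof.
rewrite (@ratr_p_integral _ 1 c) ?divr1 ?mulr1 //.
by rewrite dvdn1 gtn_eqF // prime_gt1.
Qed.

Lemma ratr_nat_p (c : nat) : (ratr c%:R : Zp) = c%:R.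
Proof. exact: (ratr_int c). Qed.

Lemma ratrD_p x y : p_integral x -> p_integral y ->
  ratr (x + y) = ratr x + ratr y :> Zp.
Proof.
move=> [D pD /intrP[c xD]] [E pE /intrP[e yE]].
have pDE : ~~ (p %| D * E)%N by rewrite Euclid_dvdM // negb_or pD.
rewrite (ratr_p_integral pD xD) (ratr_p_integral pE yE).
rewrite (@ratr_p_integral _ (D * E) (c * E%:Z + e * D%:Z)) //; last first.
  by rewrite intrD !intrM -xD -yE natrM; ring.
have DU : (D%:R : Zp) \is a GRing.unit by rewrite padic_nat_unit.
have EU : (E%:R : Zp) \is a GRing.unit by rewrite padic_nat_unit.
apply: (mulIr EU); apply: (mulIr DU).
have -> : (c%:~R / D%:R + e%:~R / E%:R) * E%:R * D%:R =
    (c%:~R / D%:R * D%:R) * E%:R + (e%:~R / E%:R * E%:R) * D%:R :> Zp by ring.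
rewrite !divrK // -mulrA -natrM [(E * D)%N]mulnC divrK ?padic_nat_unit //.
by rewrite intrD !intrM.
Qed.

Lemma ratrM_p x y : p_integral x -> p_integral y ->
  ratr (x * y) = ratr x * ratr y :> Zp.
Proof.
move=> [D pD /intrP[c xD]] [E pE /intrP[e yE]].
have pDE : ~~ (p %| D * E)%N by rewrite Euclid_dvdM // negb_or pD.
rewrite (ratr_p_integral pD xD) (ratr_p_integral pE yE).
rewrite (@ratr_p_integral _ (D * E) (c * e)) //; last first.
  by rewrite intrM -xD -yE natrM; ring.
by rewrite natrM invrM ?padic_nat_unit // intrM [E%:R^-1 * _]mulrC mulrACA.
Qed.

Lemma ratrN_p x : p_integral x -> ratr (- x) = - ratr x :> Zp.
Proof.
move=> [D pD /intrP[c xD]]; rewrite (ratr_p_integral pD xD).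
by rewrite (@ratr_p_integral _ D (- c)) ?intrN ?mulNr ?xD.
Qed.

Lemma ratr_div_p (a n : nat) : ~~ (p %| n)%N -> ratr (a%:R / n%:R) = a%:R / n%:R :> Zp.
Proof.
move=> pn; rewrite (@ratr_p_integral _ n a) // divfK // pnatr_eq0.
by apply: contraNneq pn => ->.
Qed.

(** If p divided the reduced denominator, the numerator would be a unit of Z_p, yet it is z times
    that denominator, a non-unit. *)
Lemma padic_integral_ratP x : padic_integral_rat p_pr x -> p_integral x.
Proof.
move=> [z]; rewrite /ratr => zx.
have dx : z * (denq x)%:~R = (numq x)%:~R.
  apply/eqP; rewrite -tofrac_eq rmorphM /= !rmorph_int zx divfK //.
  rewrite -absz_denq -pmulrn -(rmorph_nat (@tofrac _)) tofrac_eq0.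
  by rewrite padic_natr_neq0 // absz_gt0 denq_neq0.
exists `|denq x|%N; last first.
  by rewrite -[_%:R]/(_%:Z%:~R) absz_denq -{1}[x]divq_num_den divfK ?intr_int // intr_eq0 denq_neq0.
apply/negP => pd; have : coprime `|numq x| `|denq x| := coprime_num_den x.
suff pn : (p %| `|numq x|)%N.
  by move=> cop; have := coprime_dvdl pn cop; rewrite prime_coprime // pd.
rewrite -[(p %| _)%N]negbK -(padic_nat_unit p_pr); apply/negP => nU.
have : ((numq x)%:~R : Zp) \is a GRing.unit.
  by rewrite [numq x]intEsign intrM rmorph_sign unitrMl // unitrX // unitrN1.
by rewrite -dx unitrM -absz_denq padic_nat_unit pd andbF.
Qed.

End PIntegral.

(** * Distribution of the fractions h / n modulo 1 *)

Section Distribution.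
Implicit Types (y : rat) (e : int).

(** Both lists are the n solutions v, 0 <= v < 1, of n v = n y modulo 1. *)
Lemma perm_frac_mul n e y : (0 < n)%N -> coprime n `|e| ->
  perm_eq [seq frac_part (e%:~R * (h%:R / n%:R) + y) | h <- iota 0 n]
          [seq (frac_part (n%:R * y) + h%:R) / n%:R | h <- iota 0 n].
Proof.
move=> n0 cop; have n0' : n%:R != 0 :> rat by rewrite pnatr_eq0 -lt0n.
have np : 0 < n%:R :> rat by rewrite ltr0n.
set s1 := map _ _; set s2 := map _ _.
have u1 : uniq s1.
  rewrite map_inj_in_uniq ?iota_uniq // => h h'; rewrite !mem_iota /= !add0n => hn hn'.
  move=> /eqP; rewrite frac_part_eq.
  have -> : e%:~R * (h%:R / n%:R) + y - (e%:~R * (h'%:R / n%:R) + y) =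
    (e * (h%:Z - h'%:Z))%:~R / n%:R :> rat by rewrite intrM intrB; ring.
  move=> /intrP[z /(canRL (divfK n0'))].
  rewrite -[n%:R]/(n%:Z%:~R) -intrM => /intr_inj ez.
  have : (n%:Z %| e * (h%:Z - h'%:Z))%Z by rewrite ez dvdz_mull.
  by rewrite Gauss_dvdzr ?coprimezE // -eqz_mod_dvd !modz_small // => /eqP[].
have sub : {subset s1 <= s2}.
  move=> _ /mapP[h hn ->]; set v := frac_part _.
  have nv : frac_part (n%:R * v) = frac_part (n%:R * y).
    apply: frac_part_congr.
    have -> : n%:R * v - n%:R * y = (e * h)%:~R - n%:R * (e%:~R * (h%:R / n%:R) + y - v).
      by rewrite intrM; field.
    by rewrite rpredB ?intr_int // rpredM ?natr_int ?frac_partB_int.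
  have v0 : 0 <= n%:R * v by rewrite mulr_ge0 ?frac_part_ge0 ?ltW.
  have vn : n%:R * v < n%:R by rewrite gtr_pMr ?frac_part_lt1.
  apply/mapP; exists `|Num.floor (n%:R * v)|%N.
    rewrite mem_iota /= add0n -ltz_nat gez0_abs ?floor_ge0 // floor_lt_int //.
  have flE : `|Num.floor (n%:R * v)|%N%:R = (Num.floor (n%:R * v))%:~R :> rat.
    by rewrite pmulrn gez0_abs ?floor_ge0.
  rewrite -nv flE floorE [X in X / _]addrC subrK.
  by rewrite [n%:R * v]mulrC mulfK.
apply: uniq_perm => //; last first.
  by apply: (uniq_min_size u1 sub _).2; rewrite !size_map.
by rewrite (leq_size_uniq u1 sub) // !size_map.
Qed.

Lemma big_frac_mul (T : Type) (idx : T) (op : Monoid.com_law idx) (F : rat -> T)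
    n e y : (0 < n)%N -> coprime n `|e| ->
  \big[op/idx]_(0 <= h < n) F (frac_part (e%:~R * (h%:R / n%:R) + y)) =
  \big[op/idx]_(0 <= h < n) F ((frac_part (n%:R * y) + h%:R) / n%:R).
Proof.
move=> n0 cop; rewrite /index_iota subn0.
by have := perm_big (op := op) (x := idx) _ (perm_frac_mul y n0 cop) (P := xpredT) (F := F); rewrite !big_map.
Qed.

(** Hermite's identity: each floor is a number minus its fractional part, and [big_frac_mul] sums
    the fractional parts. *)
Lemma sum_floor_shift n e y : (0 < n)%N -> coprime n `|e| ->
  \sum_(0 <= h < n) Num.floor (frac_part (e%:~R * (h%:R / n%:R)) + y) =
  Num.floor (n%:R * y).
Proof.
move=> n0 cop; have n0' : n%:R != 0 :> rat by rewrite pnatr_eq0 -lt0n.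
have := big_frac_mul +%R (fun x => Num.floor (x + y)) 0 n0 cop.
under eq_bigr do rewrite addr0; move=> ->.
rewrite mulr0 (frac_part_id (x := 0)) //; under eq_bigr do rewrite add0r.
apply: (@intr_inj rat); rewrite rmorph_sum /= floorE.
under eq_bigr do rewrite floorE; rewrite sumrB.
have := @big_frac_mul _ _ +%R id n 1 y n0 (coprimen1 n) => /=.
under eq_bigr do rewrite mul1r; move=> ->.
under [X in _ - X]eq_bigr do rewrite addrC mulrDl; rewrite !big_split /=.
by rewrite opprD addrACA subrr add0r !sumr_const_nat subn0 -[X in _ - X]mulr_natl mulrCA divff // mulr1 mulr_natl.
Qed.

End Distribution.

(** * Gamma factors at rational arguments *)

Section GammaRat.
Variables (p : nat) (p_pr : prime p) (p_odd : odd p).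
Variable L : fieldExtType (padic p_pr).
Local Notation Zp := (padic_int p_pr).
Local Notation Gamma := (@morita_gamma p p_pr).
Local Notation G := (gamma_rat L).

Fact padic_in_is_zmod : zmod_morphism (@padic_in p p_pr L).
Proof. by move=> x y; rewrite /padic_in rmorphB scalerBl. Qed.

Fact padic_in_is_monoid : monoid_morphism (@padic_in p p_pr L).
Proof.
split=> [|x y]; first by rewrite /padic_in rmorph1 scale1r.
by rewrite /padic_in rmorphM -scalerAl -scalerA mul1r.
Qed.

HB.instance Definition _ :=
  GRing.isZmodMorphism.Build Zp L (@padic_in p p_pr L) padic_in_is_zmod.
HB.instance Definition _ :=
  GRing.isMonoidMorphism.Build Zp L (@padic_in p p_pr L) padic_in_is_monoid.

Lemma padic_in_eq0 (x : Zp) : (padic_in L x == 0) = (x == 0).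
Proof. by rewrite /padic_in scaler_eq0 oner_eq0 orbF tofrac_eq0. Qed.

Lemma padic_in_unit_neq0 (x : Zp) : x \is a GRing.unit -> padic_in L x != 0.
Proof.
by rewrite padic_in_eq0; apply: contraTneq => ->; rewrite unitr0.
Qed.

Lemma natr_neq0_ext n : (0 < n)%N -> n%:R != 0 :> L.
Proof. by move=> n0; rewrite -(rmorph_nat (@padic_in p p_pr L)) padic_in_eq0 padic_natr_neq0. Qed.

Lemma oppr_p_neq0 : - p%:R != 0 :> L.
Proof. by rewrite oppr_eq0 natr_neq0_ext // prime_gt0. Qed.

Lemma gamma_rat0 : G 0 = 1.
Proof. by rewrite /gamma_rat (ratr_nat_p p_pr 0) morita_gamma0 // rmorph1. Qed.

(** With w the fractional part of z', that of z is p w - d for d = floor(p w), so d is the digit in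
    [gamma_reflection]. If z is an integer, both Gamma values are 1, and d = 0 because z' is
    p-integral. *)
Lemma gamma_rat_reflection (z z' : rat) : p_integral p z' -> z - p%:R * z' \is a Num.int ->
  G (frac_part z) * G (frac_part (- z)) =
  (-1) ^+ (z \isn't a Num.int) * (-1) ^ Num.floor (p%:R * frac_part z').
Proof.
move=> z'p zz'; set w := frac_part z'.
have wp : p_integral p w by exact: p_integral_frac.
have pzw : frac_part z = frac_part (p%:R * w).
  apply: frac_part_congr.
  have -> : z - p%:R * w = (z - p%:R * z') + p%:R * (z' - w) by ring.
  by rewrite rpredD // rpredM ?natr_int ?frac_partB_int.
have [zi|zNi] := boolP (z \is a Num.int).
  have z'i : z' \is a Num.int.
    apply: (p_integral_mulp p_pr z'p); rewrite -rpredN mulrC.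
    have -> : - (p%:R * z') = (z - p%:R * z') - z by ring.
    by rewrite rpredB.
  have -> : w = 0 by apply/eqP; rewrite frac_part_eq0.
  have -> : frac_part (- z) = 0 by apply/eqP; rewrite frac_part_eq0 rpredN.
  have -> : frac_part z = 0 by apply/eqP; rewrite frac_part_eq0.
  by rewrite gamma_rat0 mulr0 floor0 !mulr1.
have pw0 : 0 <= p%:R * w by rewrite mulr_ge0 ?frac_part_ge0.
have -> : (-1 : L) ^ Num.floor (p%:R * w) = (-1) ^+ `|Num.floor (p%:R * w)|.
  have fl0 : 0 <= Num.floor (p%:R * w) by rewrite floor_ge0.
  by rewrite -{1}(gez0_abs fl0).
set d := `|_|%N.
have dE : d%:R = p%:R * w - frac_part z :> rat.
  by rewrite pmulrn gez0_abs ?floor_ge0 // floorE pzw.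
have dp : (d < p)%N.
  have p0 : 0 < p%:R :> rat by rewrite ltr0n prime_gt0.
  rewrite -ltz_nat gez0_abs ?floor_ge0 // floor_lt_int.
  by rewrite gtr_pMr // frac_part_lt1.
have zp : p_integral p (frac_part z).
  have -> : frac_part z = p%:R * w + - d%:R by rewrite dE; ring.
  apply: p_integralD => //; first apply: p_integralM => //.
    by apply: p_integral_int; rewrite // natr_int.
  by apply: p_integral_int; rewrite // rpredN natr_int.
have pint c : p_integral p c%:R by apply: p_integral_int; rewrite // natr_int.
rewrite frac_partN // /gamma_rat -rmorphM /= (ratrD_p p_pr (pint 1%N) (p_integralN zp)).
rewrite (ratrN_p p_pr zp) (ratr_nat_p p_pr 1) (@gamma_reflection p p_pr p_odd _ (ratr w) d) //.
  by rewrite rmorphN rmorph_sign /= expr1 mulN1r.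
have -> : frac_part z = p%:R * w + - d%:R by rewrite dE; ring.
have pwp : p_integral p (p%:R * w) by apply: p_integralM.
by rewrite ratrD_p ?ratrM_p ?ratrN_p ?ratr_nat_p //; exact: p_integralN.
Qed.

Section Multiplication.
Variables (r n : nat) (r_gt0 : (0 < r)%N) (pn : ~~ (p %| n)%N).
Variables (e : int) (y : rat) (c : nat).
Local Notation q := (p ^ r)%N.
Hypotheses (e_pm1 : `|e|%N = 1%N) (c_lt : (c < q.-1)%N).
Hypothesis nyc : n%:R * y - c%:R / q.-1%:R \is a Num.int.

Let n_gt0 : (0 < n)%N. Proof. by case: n pn; rewrite ?dvdn0. Qed.
Let cop k : coprime n `|(e * (p ^ k)%N)|.
Proof. by rewrite abszM e_pm1 mul1n coprimeXr // coprime_sym prime_coprime. Qed.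

Let q1_gt0 : (0 < q.-1)%N. Proof. exact: leq_ltn_trans c_lt. Qed.
Let q1_p : ~~ (p %| q.-1)%N. Proof. exact: dvdn_predn_exp. Qed.

Let frac_ny k : frac_part (n%:R * (y * p%:R ^+ k)) = ((p ^ k * c) %% q.-1)%:R / q.-1%:R.
Proof.
have q1' : q.-1%:R != 0 :> rat by rewrite pnatr_eq0 -lt0n.
rewrite -[RHS]frac_part_id; last first.
  by rewrite divr_ge0 //= ltr_pdivrMr ?ltr0n // mul1r ltr_nat ltn_mod.
apply: frac_part_congr.
have -> : n%:R * (y * p%:R ^+ k) - ((p ^ k * c) %% q.-1)%:R / q.-1%:R =
   (n%:R * y - c%:R / q.-1%:R) * p%:R ^+ k + ((p ^ k * c) %/ q.-1)%:R.
  have := congr1 (fun m => m%:R : rat) (divn_eq (p ^ k * c) q.-1).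
  rewrite natrD !natrM natrX.
  move: ((_ %/ _)%:R) ((_ %% _)%:R) => Dk uk eqD.
  have -> : uk = p%:R ^+ k * c%:R - Dk * q.-1%:R by rewrite eqD; ring.
  by field.
by rewrite rpredD ?rpredM ?rpredX ?natr_int.
Qed.

(** For each k, multiplication by e p^k permutes the h / n modulo 1, so the numerators form
    [gamma_mul n] at the fractional part of n y p^k and the denominators [gamma_mul n 0]. As n y is
    c / (q - 1) modulo 1, the arguments run through the cycle of [gauss_multiplication_cycle]. *)
Lemma gamma_rat_multiplication :
  \prod_(0 <= k < r) \prod_(0 <= h < n)
    (G (frac_part ((e%:~R * (h%:R / n%:R) + y) * p%:R ^+ k)) /
     G (frac_part (e%:~R * (h%:R / n%:R) * p%:R ^+ k))) =
  padic_in L (padic_teich p_pr pn) ^+ c *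
  \prod_(0 <= k < r) G (frac_part (n%:R * y * p%:R ^+ k)).
Proof.
have G0 : padic_in L (gamma_mul n (0 : Zp)) != 0.
  apply: padic_in_unit_neq0.
  by apply: rpred_prod => h _; exact: morita_gamma_unit.
have GmulE k y' : \prod_(0 <= h < n) G (frac_part ((e%:~R * (h%:R / n%:R) + y') * p%:R ^+ k)) =
    \prod_(0 <= h < n) G ((frac_part (n%:R * (y' * p%:R ^+ k)) + h%:R) / n%:R).
  rewrite -(big_frac_mul *%R G (y' * p%:R ^+ k) n_gt0 (cop k)).
  apply: eq_bigr => h _; congr (G (frac_part _)).
  by rewrite intrM -pmulrn natrX; ring.
have den k : \prod_(0 <= h < n) G (frac_part (e%:~R * (h%:R / n%:R) * p%:R ^+ k)) =
    padic_in L (gamma_mul n 0).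
  transitivity (\prod_(0 <= h < n) G (frac_part ((e%:~R * (h%:R / n%:R) + 0) * p%:R ^+ k))).
    by apply: eq_bigr => h _; rewrite addr0.
  rewrite GmulE mul0r mulr0 (frac_part_id (x := 0)) // big_mkord rmorph_prod.
  by apply: eq_bigr => h _; rewrite !add0r /gamma_rat ratr_div_p.
have num k : \prod_(0 <= h < n) G (frac_part ((e%:~R * (h%:R / n%:R) + y) * p%:R ^+ k)) =
    padic_in L (gamma_mul n (((p ^ k * c) %% q.-1)%:R / q.-1%:R)).
  rewrite GmulE frac_ny big_mkord rmorph_prod; apply: eq_bigr => h _.
  rewrite /gamma_rat; congr (padic_in L (Gamma _)).
  have xp := @p_integral_div p ((p ^ k * c) %% q.-1) _ q1_p.
  have hp : p_integral p h%:R by apply: p_integral_int; rewrite // natr_int.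
  have np : p_integral p n%:R^-1 by rewrite -[_^-1]mul1r; exact: (p_integral_div 1).
  rewrite (ratrM_p p_pr (p_integralD p_pr xp hp) np) (ratrD_p p_pr xp hp).
  have nV : ratr n%:R^-1 = n%:R^-1 :> Zp.
    by have := ratr_div_p p_pr 1 pn; rewrite !mul1r.
  by rewrite nV ratr_div_p // ratr_nat_p.
under eq_bigr do rewrite prodf_div num den.
rewrite prodf_div prodr_const_nat subn0; apply: (mulIf (expf_neq0 r G0)).
rewrite divfK ?expf_neq0 // !big_mkord mulrAC.
have := congr1 (@padic_in p p_pr L) (gauss_multiplication_cycle p_pr p_odd pn r_gt0 c_lt).
rewrite !(rmorphM, rmorph_prod, rmorphXn) /= => ->; congr (_ * _).
by apply: eq_bigr => k _; rewrite /gamma_rat -mulrA frac_ny ratr_div_p.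
Qed.

Lemma gamma_term_multiplication :
  \prod_(0 <= k < r) \prod_(0 <= h < n)
    (G (frac_part ((e%:~R * (h%:R / n%:R) + y) * p%:R ^+ k)) /
     G (frac_part (e%:~R * (h%:R / n%:R) * p%:R ^+ k)) *
     (- p%:R) ^ (- Num.floor (frac_part (e%:~R * (h%:R / n%:R) * p%:R ^+ k) + y * p%:R ^+ k))) =
  padic_in L (padic_teich p_pr pn) ^+ c *
  \prod_(0 <= k < r) (G (frac_part (n%:R * y * p%:R ^+ k)) *
                      (- p%:R) ^ (- Num.floor (n%:R * y * p%:R ^+ k))).
Proof.
under eq_bigr do rewrite big_split /=.
rewrite big_split /= gamma_rat_multiplication big_split /= mulrA; congr (_ * _).
apply: eq_bigr => k _; rewrite -mulrA -(sum_floor_shift _ n_gt0 (cop k)).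
have expD (f : nat -> int) m : \prod_(0 <= h < m) (- p%:R : L) ^ (f h) =
    (- p%:R) ^ (\sum_(0 <= h < m) f h).
  elim: m => [|m IH]; first by rewrite !big_geq // expr0z.
  by rewrite !big_nat_recr //= IH expfzDr // oppr_p_neq0.
rewrite expD sumrN; congr (_ ^ (- _)); apply: eq_bigr => h _.
congr (Num.floor (frac_part _ + _)).
by rewrite intrM -pmulrn natrX; ring.
Qed.

End Multiplication.
End GammaRat.

(** * Reflection over the common zeros *)

Section FloorSum.
Implicit Types x y z w : rat.

Lemma floorN_sum x : Num.floor x + Num.floor (- x) = - ((x \isn't a Num.int) : nat)%:Z.
Proof.
apply: (@intr_inj rat); rewrite intrD (floorE x) (floorE (- x)).
have [xi|xNi] := boolP (x \is a Num.int).
  have -> : frac_part x = 0 by apply/eqP; rewrite frac_part_eq0.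
  have -> : frac_part (- x) = 0 by apply/eqP; rewrite frac_part_eq0 rpredN.
  by rewrite !subr0 subrr.
by rewrite frac_partN //= intrN; ring.
Qed.

Lemma frac_partN_sum x : frac_part x + frac_part (- x) = ((x \isn't a Num.int) : nat)%:R.
Proof.
have [xi|xNi] := boolP (x \is a Num.int); last by rewrite frac_partN // subrKC.
have -> : frac_part x = 0 by apply/eqP; rewrite frac_part_eq0.
by rewrite add0r; apply/eqP; rewrite frac_part_eq0 rpredN.
Qed.

Lemma floor_frac_sum z w :
  Num.floor (frac_part z + w) + Num.floor (frac_part (- z) - w) =
  ((z + w \is a Num.int) : nat)%:Z - ((z \is a Num.int) : nat)%:Z.
Proof.
have -> : frac_part (- z) - w = - (frac_part z + w) + ((z \isn't a Num.int) : nat)%:R.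
  by rewrite -frac_partN_sum; ring.
rewrite [X in _ + X]floorDrz ?natr_int // addrA floorN_sum.
have -> : (frac_part z + w \is a Num.int) = (z + w \is a Num.int).
  have -> : z + w = (z - frac_part z) + (frac_part z + w) by ring.
  by rewrite (rpredDl _ (frac_partB_int z)).
rewrite (intrKfloor ((z \isn't a Num.int) : nat)).
by case: (z + w \is a Num.int) (z \is a Num.int) => -[].
Qed.

End FloorSum.

Section CommonPart.
Variables (p : nat) (p_pr : prime p) (p_odd : odd p).
Variable L : fieldExtType (padic p_pr).
Local Notation G := (gamma_rat L).
Implicit Types (x y w : rat) (s : seq rat).

Lemma signz_odd (a : nat) (z : int) : odd a -> (-1 : L) ^ (a%:Z * z) = (-1) ^ z.
Proof. by move=> a_odd; rewrite -exprz_exp -exprnP -signr_odd a_odd expr1. Qed.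

Lemma signzD (a b : int) : (-1 : L) ^ (a + b) = (-1) ^ a * (-1) ^ b.
Proof. by rewrite expfzDr // oppr_eq0 oner_eq0. Qed.

Lemma signzN (a : int) : (-1 : L) ^ (- a) = (-1) ^ a.
Proof. by rewrite -exprz_inv invrN invr1. Qed.

Lemma signz_sqr (a : int) : (-1 : L) ^ a * (-1) ^ a = 1.
Proof. by rewrite -{1}(signzN a) -signzD addNr. Qed.

(** With v = p^i <w>, the floor of p <v> is floor(p v) - p floor(v); as p is odd, the coefficient p
    does not affect the sign and the product telescopes. *)
Lemma signz_floor_telescope r w :
  \prod_(0 <= k < r) (-1 : L) ^ Num.floor (p%:R * frac_part (w * p%:R ^+ k)) =
  (-1) ^ Num.floor (p%:R ^+ r * w) * (-1) ^ Num.floor w.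
Proof.
transitivity ((-1 : L) ^ Num.floor (p%:R ^+ r * frac_part w)).
  elim: r => [|r IH].
    rewrite big_geq // expr0 mul1r (@floor_def _ _ 0) ?expr0z //.
    by rewrite frac_part_ge0 frac_part_lt1.
  rewrite big_nat_recr //= IH -[in LHS](@signz_odd p) // -signzD; congr (_ ^ _).
  apply: (@intr_inj rat); rewrite intrD intrM (floorE (p%:R ^+ r * frac_part w)) (floorE (p%:R * _)) (floorE (p%:R ^+ r.+1 * _)).
  have -> : frac_part (w * p%:R ^+ r) = frac_part (p%:R ^+ r * frac_part w).
    apply: frac_part_congr; rewrite mulrC -mulrBr.
    by rewrite rpredM ?rpredX ?natr_int ?frac_partB_int.
  rewrite exprS -mulrA; set v := p%:R ^+ r * _.
  have -> : frac_part (p%:R * frac_part v) = frac_part (p%:R * v).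
    apply: frac_part_congr; rewrite -mulrBr -opprB mulrN rpredN.
    by rewrite rpredM ?natr_int ?frac_partB_int.
  by rewrite -pmulrn; ring.
have -> : p%:R ^+ r * frac_part w = p%:R ^+ r * w + - (p ^ r)%N%:R * (Num.floor w)%:~R.
  by rewrite /frac_part natrX; ring.
rewrite floorDrz; last by rewrite mulNr rpredN rpredM ?natr_int ?intr_int.
rewrite signzD; congr (_ * _).
have -> : - (p ^ r)%N%:R * (Num.floor w)%:~R = (- ((p ^ r)%N%:Z * Num.floor w))%:~R :> rat.
  by rewrite intrN intrM mulNr.
by rewrite intrKfloor signzN signz_odd // oddX p_odd orbT.
Qed.

(** The factor of the summand at one parameter x and one k: (e, y) is (1, - t) for the a_i and (-1,
    t) for the b_i, with t = j / (q - 1). *)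
Definition hyp_term (e : int) y (k : nat) x : L :=
  G (frac_part ((e%:~R * x + y) * p%:R ^+ k)) / G (frac_part (e%:~R * x * p%:R ^+ k)) *
  (- p%:R) ^ (- Num.floor (frac_part (e%:~R * x * p%:R ^+ k) + y * p%:R ^+ k)).

Lemma hyp_term_congr e y k x x' : x - x' \is a Num.int -> hyp_term e y k x = hyp_term e y k x'.
Proof.
move=> xx'; rewrite /hyp_term.
have xi : e%:~R * (x - x') * p%:R ^+ k \is a Num.int.
  by rewrite rpredM ?rpredX ?natr_int // rpredM ?intr_int.
have -> : frac_part ((e%:~R * x + y) * p%:R ^+ k) = frac_part ((e%:~R * x' + y) * p%:R ^+ k).
  by apply: frac_part_congr; rewrite -mulrBl opprD addrACA subrr addr0 -mulrBr.
suff -> : frac_part (e%:~R * x * p%:R ^+ k) = frac_part (e%:~R * x' * p%:R ^+ k) by [].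
by apply: frac_part_congr; rewrite -mulrBl -mulrBr.
Qed.

Lemma p_integral_expE k x : p_integral p x -> (x * p%:R ^+ k \is a Num.int) = (x \is a Num.int).
Proof.
move=> xp; apply/idP/idP => [|xi]; last by rewrite rpredM ?rpredX ?natr_int.
elim: k => [|k IH]; first by rewrite mulr1.
rewrite exprSr mulrA => /p_integral_mulp H; apply/IH/H => //.
by apply: p_integralM => //; apply: p_integral_int; rewrite // rpredX ?natr_int.
Qed.

(** b and b0 tell whether the shifted and the unshifted argument are integers. The signs from
    reflection cancel that of the power of -p. *)
Lemma sign_pow_p (b b0 : bool) :
  (-1) ^+ (~~ b) / (-1) ^+ (~~ b0) * (- p%:R) ^ (- ((b : nat)%:Z - (b0 : nat)%:Z)) =
  p%:R ^ ((b0 : nat)%:Z - (b : nat)%:Z) :> L.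
Proof.
have p0 : p%:R != 0 :> L by rewrite natr_neq0_ext // prime_gt0.
case: b b0 => -[] /=; rewrite ?subrr ?subr0 ?sub0r ?oppr0 ?opprK ?expr0z ?expr1z ?exprN1.
- by rewrite divr1 mulr1.
- by rewrite expr0 expr1 invrN1 mul1r invrN mulrNN mul1r.
- by rewrite expr0 expr1 divr1 mulrNN mul1r.
- by rewrite expr1 divff ?mulr1 // oppr_eq0 oner_eq0.
Qed.

Section ReflectionTerm.
Variables (r j : nat) (r_gt0 : (0 < r)%N) (q1_gt0 : (0 < (p ^ r).-1)%N).
Local Notation q := (p ^ r)%N.
Local Notation t := (j%:R / q.-1%:R : rat).
Local Notation t' := (j%:R * p%:R ^+ r.-1 / q.-1%:R : rat).

Let q1_p : ~~ (p %| q.-1)%N. Proof. exact: dvdn_predn_exp. Qed.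

Let q1' : q.-1%:R != 0 :> rat. Proof. by rewrite pnatr_eq0 -lt0n. Qed.

Let pt' : p%:R * t' = t + j%:R.
Proof.
have -> : p%:R * t' = j%:R * (p%:R ^+ r.-1.+1) / q.-1%:R :> rat by rewrite exprS; ring.
rewrite prednK // -natrX -[q]prednK ?expn_gt0 ?prime_gt0 // -addn1 natrD addn1 /=.
by field.
Qed.

(** Pairs the end signs that telescoping leaves for x - t' and for x; it depends on y modulo 1
    only. *)
Let sgn_shift y : L := (-1) ^ Num.floor (y - t') * (-1) ^ Num.floor y.

(* With w = x - t', p * t' = t modulo 1: replacing x by p * x makes the        *)
(* p-adic digit of (p x - t) p^k the floor of p <w p^k>.                       *)
Lemma hyp_term_reflection x : p_integral p x ->
  \prod_(0 <= k < r) (hyp_term 1 (- t) k (p%:R * x) * hyp_term (-1) t k (p%:R * x)) =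
  q%:R ^ (((p%:R * x \is a Num.int) : nat)%:Z - ((p%:R * x - t \is a Num.int) : nat)%:Z) *
  ((-1) ^+ j * (sgn_shift (p%:R ^+ r * x) * sgn_shift x)).
Proof.
move=> xp; set b0 := _ \is a _; set b := _ \is a _.
have intp i : p_integral p i%:R by apply: p_integral_int; rewrite // natr_int.
have tp : p_integral p t by exact: p_integral_div.
have t'p : p_integral p t' by rewrite -natrX -natrM; exact: p_integral_div.
have pXp k : p_integral p (p%:R ^+ k) by rewrite -natrX.
have pxp : p_integral p (p%:R * x) by exact: p_integralM.
have step k : hyp_term 1 (- t) k (p%:R * x) * hyp_term (-1) t k (p%:R * x) =
   p%:R ^ ((b0 : nat)%:Z - (b : nat)%:Z) *
   ((-1) ^ Num.floor (p%:R * frac_part ((x - t') * p%:R ^+ k)) *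
    (-1) ^ Num.floor (p%:R * frac_part (x * p%:R ^+ k))).
  rewrite /hyp_term rmorph1 rmorphN1 !mulN1r !mul1r.
  set z := (p%:R * x - t) * p%:R ^+ k; set z0 := p%:R * x * p%:R ^+ k.
  have -> : (- (p%:R * x) + t) * p%:R ^+ k = - z by rewrite /z; ring.
  have -> : - (p%:R * x) * p%:R ^+ k = - z0 by rewrite /z0; ring.
  have R := @gamma_rat_reflection p p_pr p_odd L z ((x - t') * p%:R ^+ k).
  have {}R := R (p_integralM p_pr (p_integralD p_pr xp (p_integralN t'p)) (pXp k)).
  have {R}/R R : z - p%:R * ((x - t') * p%:R ^+ k) \is a Num.int.
    have -> : z - p%:R * ((x - t') * p%:R ^+ k) = (p%:R * t' - t) * p%:R ^+ k by rewrite /z; ring.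
    by rewrite pt' addrC addKr rpredM ?rpredX ?natr_int.
  have R0 := @gamma_rat_reflection p p_pr p_odd L z0 (x * p%:R ^+ k) (p_integralM p_pr xp (pXp k)).
  have {R0}/R0 R0 : z0 - p%:R * (x * p%:R ^+ k) \is a Num.int.
    by rewrite /z0 mulrA subrr.
  have zb : (z \is a Num.int) = b.
    by rewrite /z p_integral_expE //; apply: p_integralD => //; exact: p_integralN.
  have z0b : (z0 \is a Num.int) = b0 by rewrite /z0 p_integral_expE.
  rewrite mulrACA mulf_div R R0 -expfzDr ?oppr_p_neq0 // -opprD mulNr.
  rewrite -[X in frac_part (- z0) + X]opprK floor_frac_sum.
  have -> : z0 - t * p%:R ^+ k = z by rewrite /z0 /z mulrBl.
  rewrite zb z0b -[X in _ * _ / (_ * X)]signzN -invr_expz invfM invrK.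
  rewrite -sign_pow_p mulrACA -!mulrA; do 2!congr (_ * _).
  by rewrite mulrA mulrC.
under eq_bigr do rewrite step.
rewrite big_split /= prodr_const_nat subn0; congr (_ * _).
  by rewrite exprnP -exprzAC -exprnP natrX.
rewrite big_split /= !signz_floor_telescope.
have -> : p%:R ^+ r * (x - t') = p%:R ^+ r * x - t' + (- ((p ^ r.-1)%N%:Z * j%:Z))%:~R.
  have -> : (- ((p ^ r.-1)%N%:Z * j%:Z))%:~R = - (q.-1%:R * t').
    by rewrite intrN intrM -!pmulrn natrX mulrC; field.
  have -> : p%:R ^+ r = q.-1%:R + 1 :> rat.
    by rewrite -natrX -[q]prednK ?expn_gt0 ?prime_gt0 // -addn1 natrD addn1.
  by ring.
rewrite floorDrz ?intr_int // intrKfloor signzD signzN signz_odd ?oddX ?p_odd ?orbT //.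
rewrite /sgn_shift -exprnP -!mulrA mulrCA; congr (_ * (_ * _)).
exact: mulrCA.
Qed.

(** As [s] is stable under multiplication by p modulo 1, x may be replaced by p x before reflecting.
    The same stability makes the products of [sgn_shift] at p^r x and at x equal, so these signs
    cancel. The powers of q count the x equal to 0 and to t. *)
Lemma hyp_term_common s : (j < q.-1)%N ->
  (forall x, x \in s -> p_integral p x /\ 0 <= x < 1) ->
  perm_eq [seq frac_part (p%:R * x) | x <- s] s ->
  \prod_(x <- s) \prod_(0 <= k < r) (hyp_term 1 (- t) k x * hyp_term (-1) t k x) =
  (-1) ^+ (j * size s) * q%:R ^ ((count_mem 0 s)%:Z - (count_mem t s)%:Z).
Proof.
move=> jq s_int s_perm.
have mulp (F : rat -> L) : (forall x y, x - y \is a Num.int -> F x = F y) ->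
    \prod_(x <- s) F (p%:R * x) = \prod_(x <- s) F x.
  move=> Fper; rewrite -[RHS](perm_big _ s_perm) big_map; apply: eq_bigr => x _.
  by apply: Fper; exact: frac_partB_int.
rewrite -mulp; last first.
  move=> x y xy; apply: eq_bigr => k _.
  by rewrite (hyp_term_congr _ _ _ xy) (hyp_term_congr _ _ _ xy).
rewrite (eq_big_seq _ (fun x xs => hyp_term_reflection (s_int x xs).1)).
rewrite big_split /= (mulp (fun z => q%:R ^ (((z \is a Num.int) : nat)%:Z - ((z - t \is a Num.int) : nat)%:Z))); last first.
  move=> x y xy; have -> : (x \is a Num.int) = (y \is a Num.int).
    by rewrite -{1}(subrK y x) rpredDl.
  by rewrite -{1}(subrK y x) -addrA rpredDl.
rewrite mulrC; congr (_ * _).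
  have sgn_per x y : x - y \is a Num.int -> sgn_shift x = sgn_shift y.
    move=> /intrP[z xy]; rewrite /sgn_shift -(subrK y x) xy [_ + y]addrC.
    rewrite [y + _ - t']addrAC.
    have floorDz (w : rat) : Num.floor (w + z%:~R) = Num.floor w + z.
      by rewrite floorDrz ?intr_int // intrKfloor.
    rewrite (floorDz y) (floorDz (y - t')) !signzD.
    by rewrite mulrACA signz_sqr mulr1.
  have sgn_p i : \prod_(x <- s) sgn_shift (p%:R ^+ i * x) = \prod_(x <- s) sgn_shift x.
    elim: i => [|i IH]; first by apply: eq_bigr => x _; rewrite mul1r.
    rewrite -IH -(mulp (fun x => sgn_shift (p%:R ^+ i * x))).
      by apply: eq_bigr => x _; rewrite exprSr mulrA.
    move=> x y xy; apply: sgn_per; rewrite -mulrBr.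
    by rewrite rpredM ?rpredX ?natr_int.
  rewrite big_split /= big_split /= sgn_p -big_split /= [X in _ * X]big1 ?mulr1.
    by rewrite exprM; elim: (s) => [|x s' IH]; rewrite ?big_nil // big_cons IH exprS.
  by move=> x _; rewrite /sgn_shift mulrACA !signz_sqr mulr1.
have q0 : q%:R != 0 :> L by rewrite natr_neq0_ext // expn_gt0 prime_gt0.
elim: s s_int {s_perm mulp} => [|x s IH] s_int; first by rewrite big_nil subrr.
rewrite big_cons IH /= => [|z zs]; last by apply: s_int; rewrite inE zs orbT.
have [xp x01] := s_int x (mem_head _ _).
rewrite -expfzDr //; congr (_ ^ _).
have -> : (x \is a Num.int) = (x == 0) by rewrite -frac_part_eq0 frac_part_id.
have -> : (x - t \is a Num.int) = (x == t).
  rewrite -frac_part_eq !frac_part_id // divr_ge0 //= ltr_pdivrMr ?ltr0n // mul1r.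
  by rewrite ltr_nat.
by rewrite !PoszD; ring.
Qed.

End ReflectionTerm.
End CommonPart.

(** * The Teichmuller character *)

Section TeichmullerLift.
Local Open Scope classical_set_scope.
Variables (p r : nat) (p_pr : prime p).
Variables (F : finFieldType) (F_card : #|F| = (p ^ r)%N).
Variables (L : fieldExtType (padic p_pr)) (res : L -> F).
Hypothesis L_unram : unramified_residue res.
Local Notation Zp := (padic_int p_pr).
Local Notation q := (p ^ r)%N.
Local Notation integral := (@integral_elt p p_pr L).
Implicit Types (x y : L) (c : F).

Let resD := residueD L_unram.
Let resM := residueM L_unram.
Let res1 := residue1 L_unram.

(** The quotient modulo p^n is read off from z modulo p^(n+1). *)
Lemma padic_dvd_p (z : Zp) : padic_red 0 z = 0 -> exists u, z = p%:R * u.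
Proof.
move=> z0; have p0 := prime_gt0 p_pr.
have pz n : (p %| padic_mod z n.+1)%N.
  move: z0 => /eqP; rewrite -(rmorph0 (@padic_red p p_pr 0)) padic_red_eqE.
  by rewrite [padic_mod 0 _]mod0n (padic_mod_le z (ltn0Sn n)) expn1.
have uP n : (padic_mod z n.+2 %/ p = padic_mod z n.+1 %/ p %[mod p ^ n])%N.
  rewrite (padic_modP z n.+1); move: (divnK (pz n.+1)); set m := (_ %/ p)%N => <-.
  by rewrite expnSr -muln_modl // mulnK // modn_mod.
exists (padic_of p_pr uP); apply: padic_red_inj => M.
rewrite rmorphM /= padic_red_nat /padic_red -natrM; apply/eqP.
rewrite (eq_Zp_nat p_pr) [padic_mod (padic_of _ _) _]/= modnMmr mulnC divnK //.
by rewrite (padic_mod_le z (leqnSn M.+1)) modn_mod.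
Qed.

Let integral_Zp (z : Zp) : integral (padic_in L z).
Proof. exact: (integral_id (@padic_in p p_pr L)). Qed.

Let integralM x y : integral x -> integral y -> integral (x * y).
Proof. exact: (integral_mul (RtoK := @padic_in p p_pr L)). Qed.

Let integralX x n : integral x -> integral (x ^+ n).
Proof.
move=> xi; elim: n => [|n IH]; last by rewrite exprS; exact: integralM.
by rewrite expr0 -(rmorph1 (@padic_in p p_pr L)); exact: integral_Zp.
Qed.

Let integralS I (s : seq I) (f : I -> L) :
  (forall i, integral (f i)) -> integral (\sum_(i <- s) f i).
Proof.
move=> fi; elim: s => [|i s IH].
  by rewrite big_nil -(rmorph0 (@padic_in p p_pr L)); exact: integral_Zp.
by rewrite big_cons; apply: (integral_add (RtoK := @padic_in p p_pr L)); [exact: fi | exact: IH].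
Qed.

Let res0 : res 0 = 0.
Proof.
have i0 : integral 0 by rewrite -(rmorph0 (@padic_in p p_pr L)); exact: integral_Zp.
by apply: (addIr (res 0)); rewrite -resD // !add0r.
Qed.

Let resX x n : integral x -> res (x ^+ n) = res x ^+ n.
Proof.
move=> xi; elim: n => [|n IH]; first by rewrite !expr0 res1.
by rewrite !exprS resM ?IH //; exact: integralX.
Qed.

Let resS I (s : seq I) (f : I -> L) : (forall i, integral (f i)) ->
  res (\sum_(i <- s) f i) = \sum_(i <- s) res (f i).
Proof.
move=> fi; elim: s => [|i s IH]; first by rewrite !big_nil res0.
by rewrite !big_cons resD ?IH //; exact: integralS.
Qed.

Let q_gt1 : (1 < q)%N. Proof. by rewrite -F_card finNzRing_gt1. Qed.
Let q1_gt0 : (0 < q.-1)%N. Proof. by case: q q_gt1 => [|[]]. Qed.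

Let pF : p%:R = 0 :> F.
Proof. by apply/eqP; have /andP[] := card_finPcharP F_card p_pr. Qed.

Let r_gt0 : (0 < r)%N. Proof. by case: r q_gt1. Qed.

Definition teichmuller_lift c x := [/\ integral x, x ^+ #|F|.-1 = 1 & res x = c].

(* If x <> y then (x^N - y^N) / (x - y) vanishes, with N = q - 1, but its      *)
(* residue is N c^(N - 1) = - c^(N - 1).                                       *)
Lemma teichmuller_lift_uniq c x y :
  teichmuller_lift c x -> teichmuller_lift c y -> x = y.
Proof.
move=> [xi x1 xc] [yi y1 yc]; apply: contraTeq isT => xy.
have : (x - y) * \sum_(i < q.-1) x ^+ (q.-1.-1 - i) * y ^+ i = 0.
  by rewrite -subrXX -F_card x1 y1 subrr.
move/eqP; rewrite mulf_eq0 subr_eq0 (negPf xy) /= => /eqP /(congr1 res).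
rewrite res0 resS; last by move=> i; apply: integralM; exact: integralX.
under eq_bigr => i _.
  rewrite resM ?resX ?xc ?yc; try exact: integralX; try exact.
  rewrite -exprD subnK; last by rewrite -ltnS prednK.
  over.
rewrite sumr_const card_ord -mulr_natr => /eqP; rewrite mulf_eq0 expf_eq0.
have -> : (q.-1%:R == 0 :> F) = false.
  have : q%:R = 0 :> F by rewrite natrX pF expr0n gtn_eqF.
  rewrite -[q]prednK ?(ltnW q_gt1) // -addn1 natrD => /eqP; rewrite addr_eq0 addn1 /= => /eqP ->.
  by rewrite oppr_eq0 oner_eq0.
rewrite orbF => /andP[_ /eqP c0].
move: y1 => /(congr1 res); rewrite resX // yc c0 res1 F_card expr0n gtn_eqF //.
by move=> /esym /eqP; rewrite oner_eq0.
Qed.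

Lemma teichmuller_unique c x : teichmuller_lift c x -> teichmuller res c = x.
Proof.
by move=> xP; apply: xget_unique => // y yP; exact: teichmuller_lift_uniq yP xP.
Qed.

Let p1_dvd : (p.-1 %| q.-1)%N.
Proof. by rewrite predn_exp dvdn_mulr. Qed.

Section NatLift.
Variable n : nat.
Hypothesis pn : ~~ (p %| n)%N.
Local Notation tau := (padic_teich p_pr pn).

Let tau_exp : tau ^+ q.-1 = 1.
Proof. by case/dvdnP: p1_dvd => f ->; rewrite mulnC exprM padic_teich_exp expr1n. Qed.

Let res_tau : res (padic_in L tau) = n%:R.
Proof.
have [u tu] : exists u, tau - n%:R = p%:R * u.
  by apply: padic_dvd_p; rewrite rmorphB /= padic_teich_res subrr.
have -> : padic_in L tau = padic_in L n%:R + p%:R * padic_in L u.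
  by rewrite -(rmorph_nat (@padic_in p p_pr L) p) -rmorphM -rmorphD -tu addrCA subrr addr0.
have pi : integral p%:R.
  by rewrite -(rmorph_nat (@padic_in p p_pr L)); exact: integral_Zp.
have resp z : integral z -> res (p%:R * z) = 0.
  move=> zi; apply/(residue_ker L_unram); last by exists z.
  exact: integralM.
rewrite resD //; last exact: integralM.
rewrite resp // addr0; elim: n => [|k IH]; first by rewrite rmorph0 res0.
by rewrite -addn1 !natrD rmorphD (resD (integral_Zp _) (integral_Zp _)) IH rmorph1 res1.
Qed.

Lemma teichmuller_nat : teichmuller res n%:R = padic_in L tau.
Proof.
apply: teichmuller_unique; split => //.
by rewrite F_card -rmorphXn tau_exp rmorph1.
Qed.

Lemma teichmuller_nat_exp : (teichmuller res n%:R) ^+ q.-1 = 1.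
Proof. by rewrite teichmuller_nat -rmorphXn tau_exp rmorph1. Qed.

(* No completeness of L is needed: n has its lift in Z_p, so c and n c lift    *)
(* simultaneously, and [teichmuller] is 0 on both sides if they do not.        *)
Lemma teichmullerM_nat c :
  teichmuller res (n%:R * c) = teichmuller res n%:R * teichmuller res c.
Proof.
rewrite teichmuller_nat.
have lift_mul z d d' x : teichmuller_lift d (padic_in L z) -> teichmuller_lift d' x ->
    teichmuller_lift (d * d') (padic_in L z * x).
  move=> [zi z1 zd] [xi x1 xd]; split; first exact: integralM.
  - by rewrite exprMn z1 x1 mulr1.
  - by rewrite resM // zd xd.
have tau_lift : teichmuller_lift n%:R (padic_in L tau).
  by split => //; rewrite F_card -rmorphXn tau_exp rmorph1.
have tauV_lift : teichmuller_lift n%:R^-1 (padic_in L (tau ^+ q.-1.-1)).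
  split => //.
    by rewrite F_card -rmorphXn exprAC tau_exp expr1n rmorph1.
  have nn : n%:R * res (padic_in L (tau ^+ q.-1.-1)) = 1.
    by rewrite -res_tau -resM // -rmorphM -exprS prednK // tau_exp rmorph1 res1.
  have n0 : n%:R != 0 :> F by apply: contra_eq_neq nn => ->; rewrite mul0r eq_sym oner_eq0.
  by apply: (mulfI n0); rewrite nn divff.
have [[x xc]|noL] := pselect (exists x, teichmuller_lift c x).
  rewrite (teichmuller_unique xc); apply: teichmuller_unique.
  exact: lift_mul.
have -> : teichmuller res c = 0.
  by apply: xgetPN => x xc; apply: noL; exists x.
rewrite mulr0; apply: xgetPN => x xc; apply: noL.
exists (padic_in L (tau ^+ q.-1.-1) * x).
have n0 : n%:R != 0 :> F.
  have [_ /(congr1 res)] := tau_lift.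
  rewrite resX // res1 res_tau => n1 _; apply: contra_eq_neq n1 => ->.
  by rewrite F_card expr0n gtn_eqF // eq_sym oner_eq0.
by have := lift_mul _ _ _ _ tauV_lift xc; rewrite mulKf.
Qed.

End NatLift.

Lemma natr_F_neq0 n : ~~ (p %| n)%N -> n%:R != 0 :> F.
Proof. by rewrite (dvdn_pcharf (card_finPcharP F_card p_pr)). Qed.

Lemma teichmuller_nat_neq0 n : ~~ (p %| n)%N -> teichmuller res n%:R != 0.
Proof.
move=> pn; apply: contra_eq_neq (teichmuller_nat_exp pn) => ->.
by rewrite expr0n gtn_eqF // eq_sym oner_eq0.
Qed.

Lemma teichmullerM_prod ns c : all (fun n => ~~ (p %| n)%N) ns ->
  teichmuller res ((\prod_(n <- ns) n ^ n)%N%:R * c) =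
  (\prod_(n <- ns) (teichmuller res n%:R) ^+ n) * teichmuller res c.
Proof.
elim: ns c => [|n ns IH] c /=; first by rewrite !big_nil !mul1r.
move=> /andP[pn nsP]; rewrite !big_cons natrM -mulrA natrX.
have powM k d : teichmuller res (n%:R ^+ k * d) = (teichmuller res n%:R) ^+ k * teichmuller res d.
  elim: k => [|k IHk]; first by rewrite !mul1r.
  by rewrite !exprS -!mulrA teichmullerM_nat // IHk.
by rewrite powM IH // mulrA.
Qed.

(** M is A / B with A and B prime to p, so multiplicativity at such integers suffices. *)
Lemma teichmuller_barM ps qs j c :
  all (fun n => ~~ (p %| n)%N) ps -> all (fun n => ~~ (p %| n)%N) qs ->
  \prod_(n <- ps) (teichmuller res n%:R) ^+ (n * j) *
    teichmuller_bar res j (ratr (exponent_const ps qs) * c) =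
  \prod_(n <- qs) (teichmuller res n%:R) ^+ (n * j) * teichmuller_bar res j c.
Proof.
move=> psP qsP; set A := (\prod_(n <- ps) n ^ n)%N; set B := (\prod_(n <- qs) n ^ n)%N.
have prodP ns : all (fun n => ~~ (p %| n)%N) ns -> ~~ (p %| \prod_(n <- ns) n ^ n)%N.
  elim: ns => [|n ns IH] /=; first by rewrite big_nil dvdn1 gtn_eqF // prime_gt1.
  move=> /andP[pn /IH nsP]; rewrite big_cons Euclid_dvdM // negb_or nsP andbT.
  by apply: contra pn; rewrite Euclid_dvdX // => /andP[].
have A0 := natr_F_neq0 (prodP _ psP); have B0 := natr_F_neq0 (prodP _ qsP).
have ME : ratr (exponent_const ps qs) = A%:R / B%:R :> F.
  apply: (@ratr_int_div _ _ _ A); first by rewrite unitfE.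
  have E ns : \prod_(n <- ns) n%:R ^+ n = (\prod_(n <- ns) n ^ n)%N%:R :> rat.
    by rewrite natr_prod; apply: eq_bigr => n _; rewrite natrX.
  rewrite /exponent_const !E -/A -/B divfK // pnatr_eq0.
  by apply: contraNneq (prodP _ qsP) => B0'; rewrite -/B B0' dvdn0.
rewrite /teichmuller_bar ME !mulf_eq0 invr_eq0 (negPf A0) (negPf B0) /=.
have [|c0] := eqVneq c 0; first by rewrite !mulr0.
have key : (\prod_(n <- qs) (teichmuller res n%:R) ^+ n) * teichmuller res (A%:R / B%:R * c) =
    (\prod_(n <- ps) (teichmuller res n%:R) ^+ n) * teichmuller res c.
  rewrite -!teichmullerM_prod //; congr (teichmuller res _).
  by rewrite -/A -/B mulrA mulrCA divff // mulr1.
have W ns : all (fun n => ~~ (p %| n)%N) ns ->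
    \prod_(n <- ns) (teichmuller res n%:R) ^+ n != 0.
  move=> /allP nsP; rewrite prodf_seq_neq0; apply/allP => n /nsP pn /=.
  by rewrite expf_neq0 // teichmuller_nat_neq0.
have WX ns : \prod_(n <- ns) (teichmuller res n%:R) ^+ (n * j) =
    (\prod_(n <- ns) (teichmuller res n%:R) ^+ n) ^+ j.
  by rewrite -prodrXl; apply: eq_bigr => n _; rewrite exprM.
rewrite !WX -!exprMn; congr (_ ^+ j).
(* [teichmuller res c] is not known to be nonzero here, but inversion is multiplicative also at 0;
   only lifts of integers are cancelled. *)
rewrite -[teichmuller res c](mulKf (W _ psP)) -key !invfM invrK.
by rewrite [RHS]mulrCA (mulVKf (W _ qsP)).
Qed.

End TeichmullerLift.

(** * Parameters defined over Q *)

Section RootsPoly.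
Variable K : fieldType.
Implicit Types s sA sB sD : seq K.
Local Notation rpoly s := (\prod_(z <- s) ('X - z%:P)).

Lemma rpoly_neq0 s : rpoly s != 0 :> {poly K}.
Proof. by rewrite -size_poly_eq0 size_prod_XsubC. Qed.

Lemma mup_rpoly z s : mup z (rpoly s) = count_mem z s.
Proof.
elim: s => [|y s IH]; first by rewrite big_nil mupNroot // root1.
rewrite big_cons mupM ?rpoly_neq0 ?polyXsubC_eq0 // IH /=; congr addn.
by have := mup_XsubCX 1 z y; rewrite expr1 => ->; case: eqP.
Qed.

Lemma gcdp_rpoly sA sB sD : (forall z, z \in sA -> z \notin sB) ->
  gcdp (rpoly sA * rpoly sD) (rpoly sB * rpoly sD) %= rpoly sD.
Proof.
move=> AB.
have cop : gcdp (rpoly sA) (rpoly sB) %= 1.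
  rewrite -size_poly_eq1 -/(coprimep _ _).
  elim: sB AB => [|z sB IH] AB; first by rewrite big_nil coprimep1.
  rewrite big_cons coprimepMr coprimep_XsubC root_prod_XsubC IH ?andbT.
    by apply/negP => /AB; rewrite mem_head.
  by move=> y /AB; rewrite inE negb_or => /andP[].
rewrite -(eqp_ltrans (mulp_gcdl _ _ _)).
by have := eqp_mulr (rpoly sD) cop; rewrite mul1r.
Qed.

Lemma eqp_mup z (f g : {poly K}) : f != 0 -> f %= g -> mup z f = mup z g.
Proof.
move=> f0 fg; have g0 : g != 0 by apply: contraNneq f0 => g0; rewrite -eqp0 -g0.
apply/eqP; rewrite eqn_leq !mup_geq // -(eqp_dvdr _ fg) -mup_geq // leqnn.
by rewrite (eqp_dvdr _ fg) -mup_geq // leqnn.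
Qed.

End RootsPoly.

Section CExp.
Variable R : realType.
Local Notation C := R[i].
Local Notation cexp := (@cexp R).
Implicit Types x y : rat.

Lemma cexpD x y : cexp (x + y) = cexp x * cexp y.
Proof.
rewrite /Defs.cexp rmorphD mulrDr cosD sinD; apply/eqP; rewrite eq_complex /=.
by apply/andP; split; apply/eqP => //; rewrite addrC.
Qed.

Lemma cexp0 : cexp 0 = 1.
Proof. by rewrite /Defs.cexp rmorph0 mulr0 cos0 sin0. Qed.

Lemma cexp_int x : x \is a Num.int -> cexp x = 1.
Proof.
have nat_case (n : nat) : cexp n%:R = 1.
  elim: n => [|n IH]; first exact: cexp0.
  rewrite -addn1 natrD cexpD IH mul1r /Defs.cexp rmorph1 mulr1 mulr_natl.
  by rewrite cos2pi sin2pi.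
move=> /intrP[[n|n] ->]; first exact: nat_case.
have := cexp0; rewrite -[X in cexp X](subrr (n.+1%:R)) addrC cexpD nat_case mulr1.
by rewrite NegzE intrN.
Qed.

Lemma cexp_frac x : cexp (frac_part x) = cexp x.
Proof.
have E : x = (x - frac_part x) + frac_part x by rewrite subrK.
by rewrite [in RHS]E cexpD (cexp_int (frac_partB_int x)) mul1r.
Qed.

(** The point is that exp(2 pi i w) = 1 and 0 <= w < 1 give w = 0: otherwise sin(pi w) > 0, so cos(2
    pi w) = 1 - 2 sin(pi w)^2 < 1. *)
Lemma cexp_inj x y : (cexp x == cexp y) = (frac_part x == frac_part y).
Proof.
apply/eqP/eqP => [exy|xy]; last by rewrite -cexp_frac xy cexp_frac.
apply/eqP; rewrite frac_part_eq -frac_part_eq0; set w := frac_part _.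
have : cexp w = 1.
  by rewrite cexp_frac cexpD exy -cexpD subrr cexp0.
rewrite /Defs.cexp => -[cw _]; apply: contraT => w0.
have wp : 0 < w by rewrite lt_neqAle eq_sym w0 frac_part_ge0.
have piw : 0 < sin (pi * ratr w : R).
  apply: sin_gt0_pi; rewrite mulr_gt0 ?pi_gt0 ?ltr0q //=.
  by rewrite gtr_pMr ?pi_gt0 // -[X in _ < X](rmorph1 (@ratr R)) ltr_rat frac_part_lt1.
move: cw; rewrite -mulrA mulr_natl cos_mulr2n cos2sin2.
have : 0 < sin (pi * ratr w : R) ^+ 2 by rewrite exprn_gt0.
by move: (_ ^+ 2) => S S0 ES; exfalso; clear -S0 ES; lra.
Qed.

Lemma Xn_sub1_roots (n : nat) : (0 < n)%N ->
  'X^n - 1 = \prod_(h <- iota 0 n) ('X - (cexp (h%:R / n%:R))%:P).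
Proof.
move=> n0; have n0' : n%:R != 0 :> rat by rewrite pnatr_eq0 -lt0n.
have cexpX h : cexp (1 / n%:R) ^+ h = cexp (h%:R / n%:R).
  elim: h => [|h IH]; first by rewrite expr0 mul0r cexp0.
  by rewrite exprS IH -cexpD -mulrDl -(natrD _ 1) add1n.
have prim : n.-primitive_root (cexp (1 / n%:R)).
  apply/andP; split => //; apply/forallP => i; apply/eqP; apply/unity_rootP/eqP.
    rewrite cexpX -cexp0 => /eqP; rewrite cexp_inj frac_part_eq subr0 => /intrP[z].
    move=> /(canRL (divfK n0')); rewrite -[n%:R]/(n%:Z%:~R) -intrM => /eqP.
    rewrite -[i.+1%:R]/(i.+1%:Z%:~R) (inj_eq intr_inj) => /eqP iz.
    have : (n%:Z %| i.+1%:Z)%Z by rewrite iz dvdz_mull.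
    rewrite dvdzE /=.
    by move/(dvdn_leq (ltn0Sn i)) => ni; apply/eqP; rewrite eqn_leq ni ltn_ord.
  by move=> ->; rewrite cexpX divff // cexp_int.
rewrite -(factor_Xn_sub_1 prim) /index_iota subn0.
by apply: eq_bigr => h _; rewrite cexpX.
Qed.

(** The arguments, in units of 2 pi, of the zeros of the product of the x^n - 1, with
    multiplicity. *)
Definition unit_fracs (ns : seq nat) : seq rat :=
  flatten [seq [seq h%:R / n%:R | h <- iota 0 n] | n <- ns].

Lemma xn_sub1_prodE ns : all (leq 1) ns ->
  xn_sub1_prod R ns = \prod_(z <- map cexp (unit_fracs ns)) ('X - z%:P).
Proof.
move=> ns_gt0; rewrite big_map /unit_fracs big_flatten /= big_map.
rewrite /xn_sub1_prod; apply: eq_big_seq => n nns.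
by rewrite Xn_sub1_roots ?big_map //; exact: (allP ns_gt0).
Qed.

Lemma mem_unit_fracs x ns : x \in unit_fracs ns ->
  exists2 n, n \in ns & exists2 h : nat, (h < n)%N & x = h%:R / n%:R.
Proof.
move=> /flattenP[s /mapP[n nns ->] /mapP[h]]; rewrite mem_iota => hn ->.
by exists n => //; exists h.
Qed.

End CExp.

Section Exponents.
Local Open Scope classical_set_scope.
Variables (p : nat) (p_pr : prime p) (R : realType).
Variables (m : nat) (a b : 'I_m -> rat).
Local Notation C := R[i].
Local Notation cexp := (@cexp R).
Local Notation rpoly s := (\prod_(z <- s) ('X - z%:P) : {poly C}).

Definition param_fracs (c : 'I_m -> rat) : seq rat := [seq frac_part (c i) | i <- index_enum 'I_m].

Lemma rpoly_param_fracs c :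
  rpoly (map cexp (param_fracs c)) = \prod_(i < m) ('X - (cexp (c i))%:P).
Proof.
by rewrite !big_map; apply: eq_bigr => i _; rewrite cexp_frac.
Qed.

Lemma unit_fracs_itv ns x : x \in unit_fracs ns -> 0 <= x < 1.
Proof.
move=> /mem_unit_fracs[n _ [h hn ->]]; rewrite divr_ge0 //=.
by rewrite ltr_pdivrMr ?mul1r ?ltr_nat // ltr0n (leq_ltn_trans _ hn).
Qed.

Lemma param_fracs_itv c x : x \in param_fracs c -> 0 <= x < 1.
Proof. by move=> /mapP[i _ ->]; rewrite frac_part_ge0 frac_part_lt1. Qed.

Lemma perm_cexp (s1 s2 : seq rat) :
  (forall x, x \in s1 -> 0 <= x < 1) -> (forall x, x \in s2 -> 0 <= x < 1) ->
  perm_eq (map cexp s1) (map cexp s2) -> perm_eq s1 s2.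
Proof.
move=> s1_itv s2_itv.
pose g z : rat := xget 0 [set y : rat | 0 <= y < 1 /\ cexp y = z].
have gK s : (forall x, x \in s -> 0 <= x < 1) -> map g (map cexp s) = s.
  move=> s_itv; rewrite -map_comp -[RHS]map_id; apply/eq_in_map => x xs /=.
  apply: xget_unique => [|y [y_itv /eqP]]; first by split; first exact: s_itv.
  by rewrite cexp_inj (frac_part_id y_itv) (frac_part_id (s_itv x xs)) => /eqP.
by move=> /(perm_map g); rewrite !gK.
Qed.

Lemma exponents_perm ps qs : exponents_of R a b ps qs ->
  perm_eq (param_fracs a ++ unit_fracs qs) (param_fracs b ++ unit_fracs ps).
Proof.
case=> ps_gt0 qs_gt0; rewrite prodf_div -!rmorph_prod -!rpoly_param_fracs.
rewrite !xn_sub1_prodE // => /eqP; rewrite eqr_div ?tofrac_eq0 ?rpoly_neq0 //.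
rewrite -!rmorphM /= tofrac_eq [X in _ == X]mulrC -!big_cat -!map_cat => /eqP /prod_XsubC_eq.
by apply: perm_cexp => x; rewrite mem_cat => /orP[];
   [exact: param_fracs_itv | exact: unit_fracs_itv |
    exact: param_fracs_itv | exact: unit_fracs_itv].
Qed.

Hypotheses (a_int : forall i, p_integral p (a i)) (b_int : forall i, p_integral p (b i)).
Hypothesis ab_disjoint : forall i j, a i - b j \isn't a Num.int.
Variables (ps qs : seq nat).
Hypothesis ab_rat : defined_over_rat R a b ps qs.

Let ps_gt0 : all (leq 1) ps. Proof. by case: ab_rat => -[]. Qed.
Let qs_gt0 : all (leq 1) qs. Proof. by case: ab_rat => -[]. Qed.

Let perm_ab : perm_eq (param_fracs a ++ unit_fracs qs) (param_fracs b ++ unit_fracs ps).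
Proof. by case: ab_rat => + _; exact: exponents_perm. Qed.

Let param_int c : (forall i, p_integral p (c i)) ->
  forall x, x \in param_fracs c -> p_integral p x.
Proof. by move=> cp _ /mapP[i _ ->]; exact: p_integral_frac. Qed.

(** A shared exponent cancels from the quotient, against minimality of the number of exponents. *)
Lemma exponents_disjoint n : n \in ps -> n \notin qs.
Proof.
move=> nps; apply/negP => nqs; case: ab_rat => -[_ _ E] /(_ (rem n ps) (rem n qs)).
case=> [|]; last by rewrite size_rem //; case: (ps) nps => //= ? ?; rewrite ltnn.
have n0 : (0 < n)%N by exact: (allP ps_gt0).
have remP ns : n \in ns -> xn_sub1_prod R ns = ('X^n - 1) * xn_sub1_prod R (rem n ns).
  by move=> nns; rewrite /xn_sub1_prod (perm_big _ (perm_to_rem nns)) big_cons.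
have all_rem ns : all (leq 1) ns -> all (leq 1) (rem n ns).
  by move=> /allP ns0; apply/allP => k /mem_rem /ns0.
split; [exact: all_rem | exact: all_rem |].
rewrite E (remP _ nps) (remP _ nqs) !rmorphM /= invfM mulrACA divff ?mul1r // tofrac_eq0.
by rewrite -polyC1 monic_neq0 // monicXnsubC.
Qed.

Lemma mem_unit_fracs_inv N ns : (1 < N)%N -> all (leq 1) ns ->
  {in ns, forall n, (N %| n)%N -> (n <= N)%N} -> (1 / N%:R \in unit_fracs ns) = (N \in ns).
Proof.
move=> N1 ns_gt0 nsN; apply/idP/idP => [/mem_unit_fracs[n nns [h hn hE]]|Nns].
  have N0' : N%:R != 0 :> rat by rewrite pnatr_eq0 gtn_eqF // ltnW.
  have n0' : n%:R != 0 :> rat by rewrite pnatr_eq0 gtn_eqF // (leq_ltn_trans _ hn).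
  have : n%:R = (h * N)%:R :> rat.
    move/eqP: hE; rewrite natrM eqr_div // mul1r => /eqP //.
  move=> /eqP; rewrite eqr_nat => /eqP nE.
  suff <- : n = N by [].
  have le1 : (n <= N)%N by apply: nsN; rewrite // nE dvdn_mull.
  have h0 : (0 < h)%N by rewrite lt0n; apply: contraTneq hn => h0; rewrite nE h0.
  by apply/eqP; rewrite eqn_leq le1 nE leq_pmull.
apply/flattenP; exists [seq h%:R / N%:R | h <- iota 0 N]; first exact: map_f.
by apply/mapP; exists 1%N; rewrite ?mem_iota.
Qed.

Lemma inv_not_p_integral N : (p %| N)%N -> (0 < N)%N -> ~ p_integral p (1 / N%:R).
Proof.
move=> pN N0 [D pD /intrP[z]].
have N0' : N%:R != 0 :> rat by rewrite pnatr_eq0 gtn_eqF.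
rewrite mul1r mulrC => /(canRL (divfK N0')).
rewrite -[D%:R]/(D%:Z%:~R) -[N%:R]/(N%:Z%:~R) -intrM => /intr_inj DE.
have : (N%:Z %| D%:Z)%Z by rewrite DE dvdz_mull.
by rewrite dvdzE /= => /(dvdn_trans pN); apply/negP.
Qed.

(* For the largest exponent N divisible by p, no a_i or b_i is 1 / N modulo 1, *)
(* and N is the only exponent it divides: it would lie in both lists.          *)
Lemma exponents_coprime : all (fun n => ~~ (p %| n)%N) ps /\ all (fun n => ~~ (p %| n)%N) qs.
Proof.
suff H : all (fun n => ~~ (p %| n)%N) (ps ++ qs) by apply/andP; rewrite -all_cat.
apply: contraT; rewrite -has_predC => /hasP[N0 N0in /= /negPn pN0].
have bounded n : (n \in ps ++ qs) && (p %| n)%N -> (n <= \sum_(k <- ps ++ qs) k)%N.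
  by move=> /andP[nin _]; rewrite (big_rem _ nin) leq_addr.
have exN : exists n, (n \in ps ++ qs) && (p %| n)%N by exists N0; rewrite N0in.
have [N /andP[Nin pN] Nmax] := ex_maxnP exN bounded.
have N_gt0 : (0 < N)%N.
  by move: Nin; rewrite mem_cat => /orP[/(allP ps_gt0)|/(allP qs_gt0)].
have N1 : (1 < N)%N by rewrite (leq_trans (prime_gt1 p_pr)) // dvdn_leq.
have mem_inv ns : all (leq 1) ns -> {subset ns <= ps ++ qs} ->
    (1 / N%:R \in unit_fracs ns) = (N \in ns).
  move=> ns_gt0 nsub; apply: mem_unit_fracs_inv => // n nns Nn.
  by apply: Nmax; rewrite nsub // (dvdn_trans pN).
have notin c : (forall i, p_integral p (c i)) -> 1 / N%:R \notin param_fracs c.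
  by move=> cp; apply/negP => /(param_int cp); exact: inv_not_p_integral.
have := perm_mem perm_ab (1 / N%:R); rewrite !mem_cat !(negPf (notin _ _)) //=.
rewrite !mem_inv // => [qp|x xps|x xqs]; try by rewrite mem_cat ?xps ?xqs ?orbT.
move: Nin; rewrite mem_cat -qp orbb => Nqs.
by have := exponents_disjoint; move=> /(_ N); rewrite -qp Nqs => /(_ isT).
Qed.

Lemma unit_fracs_p_integral ns x : all (fun n => ~~ (p %| n)%N) ns ->
  x \in unit_fracs ns -> p_integral p x.
Proof.
by move=> /allP nsp /mem_unit_fracs[n /nsp pn [h _ ->]]; exact: p_integral_div.
Qed.

Lemma perm_mulp_unit_fracs ns : all (fun n => ~~ (p %| n)%N) ns ->
  perm_eq [seq frac_part (p%:R * x) | x <- unit_fracs ns] (unit_fracs ns).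
Proof.
elim: ns => //= n ns IH /andP[pn /IH]; rewrite /unit_fracs /= map_cat; apply: perm_cat.
have n0 : (0 < n)%N by case: n pn; rewrite ?dvdn0.
have cop : coprime n `|p%:Z| by rewrite coprime_sym prime_coprime.
have := perm_frac_mul 0 n0 cop; rewrite mulr0 (frac_part_id (x := 0)) //.
rewrite -map_comp => H; apply: (perm_trans _ (perm_trans H _)).
  by apply/permP => P; congr count; apply: eq_map => h /=; rewrite addr0.
by apply/permP => P; congr count; apply: eq_map => h /=; rewrite add0r.
Qed.

(** [s] is what remains of the fractions h / p_i once the a_i are removed. No a_i equals a b_j
    modulo 1, so the multiplicity of a point in [s] is the smaller of its multiplicities in the two
    lists of fractions: [s] lists the zeros of the gcd. *)
Lemma common_fracs : exists s : seq rat,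
  [/\ perm_eq (unit_fracs ps) (param_fracs a ++ s) /\
      perm_eq (unit_fracs qs) (param_fracs b ++ s),
      perm_eq [seq frac_part (p%:R * x) | x <- s] s,
      forall x, x \in s -> p_integral p x /\ 0 <= x < 1,
      common_degree R ps qs = size s &
      forall q c, (c < q.-1)%N ->
        common_mult R ps qs q c = count_mem (c%:R / q.-1%:R) s].
Proof.
have [pps pqs] := exponents_coprime.
have disj x : x \in param_fracs a -> x \notin param_fracs b.
  move=> /mapP[i _ ->]; apply/negP => /mapP[j _ /eqP].
  by rewrite frac_part_eq (negPf (ab_disjoint i j)).
have cnt := permP perm_ab.
have /count_subseqP[t tP tA] x : (count_mem x (param_fracs a) <= count_mem x (unit_fracs ps))%N.
  have [xa|/count_memPn ->//] := boolP (x \in param_fracs a).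
  have := cnt (pred1 x); rewrite !count_cat (count_memPn (disj _ xa)) add0n => <-.
  exact: leq_addr.
have [s sP] := perm_to_subseq tP; exists s.
have PA : perm_eq (unit_fracs ps) (param_fracs a ++ s).
  by rewrite (perm_trans sP) // perm_cat2r perm_sym.
have QB : perm_eq (unit_fracs qs) (param_fracs b ++ s).
  rewrite -(perm_cat2l (param_fracs a)) (perm_trans perm_ab) // perm_sym perm_catCA.
  by rewrite perm_cat2l perm_sym.
have s_int x : x \in s -> p_integral p x /\ 0 <= x < 1.
  move=> xs; have xP : x \in unit_fracs ps by rewrite (perm_mem PA) mem_cat xs orbT.
  by split; [exact: unit_fracs_p_integral xP | exact: unit_fracs_itv xP].
have comE : common_poly R ps qs %= rpoly (map cexp s).
  rewrite /common_poly !xn_sub1_prodE // (perm_big _ (perm_map cexp PA)).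
  rewrite (perm_big _ (perm_map cexp QB)) /= !map_cat !big_cat /=.
  apply: gcdp_rpoly => _ /mapP[x xa ->]; apply/negP => /mapP[y yb /eqP].
  rewrite cexp_inj !frac_part_id ?(param_fracs_itv xa) ?(param_fracs_itv yb) // => /eqP xy.
  by have := disj _ xa; rewrite xy yb.
have com0 : common_poly R ps qs != 0 by rewrite -eqp0 (eqp_ltrans comE) eqp0 rpoly_neq0.
split => //.
- pose phi x := frac_part (p%:R * x).
  (* The minimum depends only on the two lists of fractions, which multiplication by p permutes. It
     also keeps the a_i and b_j disjoint modulo 1, by [p_integral_mulp], so the image of [s] has the
     multiplicities of [s]. *)
  have min_count (P Q A B S : seq rat) y : perm_eq P (A ++ S) -> perm_eq Q (B ++ S) ->
      (y \in A -> y \notin B) -> count_mem y S = minn (count_mem y P) (count_mem y Q).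
    move=> /permP /(_ (pred1 y)) + /permP /(_ (pred1 y)); rewrite !count_cat => -> -> AB.
    have [/AB /count_memPn ->|/count_memPn ->] := boolP (y \in A).
      by symmetry; apply/minn_idPr; rewrite add0n leq_addl.
    by symmetry; apply/minn_idPl; rewrite add0n leq_addl.
  apply/allP => y _ /=; apply/eqP.
  rewrite (min_count (unit_fracs ps) (unit_fracs qs) (map phi (param_fracs a)) (map phi (param_fracs b))).
  + by rewrite (min_count (unit_fracs ps) (unit_fracs qs) (param_fracs a) (param_fracs b) s) //; exact: disj.
  + rewrite -map_cat perm_sym -(permPr (perm_mulp_unit_fracs pps)).
    by apply: perm_map; rewrite perm_sym.
  + rewrite -map_cat perm_sym -(permPr (perm_mulp_unit_fracs pqs)).
    by apply: perm_map; rewrite perm_sym.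
  + move=> /mapP[x xa ->]; apply/negP => /mapP[x' xb /eqP].
    rewrite /phi frac_part_eq -mulrBr mulrC => /(p_integral_mulp p_pr) xx'.
    have : x - x' \is a Num.int.
      apply: xx'; apply: p_integralD => //; first exact: param_int xa.
      by apply: p_integralN; exact: param_int xb.
    rewrite -frac_part_eq !frac_part_id ?(param_fracs_itv xa) ?(param_fracs_itv xb) //.
    by move=> /eqP xE; have := disj _ xa; rewrite xE xb.
- by rewrite /common_degree (eqp_size comE) size_prod_XsubC size_map.
- move=> q c cq; rewrite /common_mult (eqp_mup _ com0 comE) mup_rpoly count_map.
  have c_itv : 0 <= (c%:R / q.-1%:R : rat) < 1.
    rewrite divr_ge0 //= ltr_pdivrMr ?mul1r ?ltr_nat // ltr0n.
    exact: leq_ltn_trans cq.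
  apply: eq_in_count => x /s_int[_ x_itv] /=.
  by rewrite cexp_inj (frac_part_id x_itv) (frac_part_id c_itv).
Qed.

End Exponents.

(** * The theorem *)

Section UnitFracsTerm.
Variables (p r : nat) (p_pr : prime p) (p_odd : odd p).
Variables (F : finFieldType) (F_card : #|F| = (p ^ r)%N).
Variables (L : fieldExtType (padic p_pr)) (res : L -> F).
Hypothesis L_unram : unramified_residue res.
Local Notation q := (p ^ r)%N.
Local Notation w n := (teichmuller res n%:R).
Implicit Types (ns : seq nat) (j : nat).

Let q_gt1 : (1 < q)%N. Proof. by rewrite -F_card finNzRing_gt1. Qed.
Let q1_gt0 : (0 < q.-1)%N. Proof. by case: q q_gt1 => [|[]]. Qed.
Let r_gt0 : (0 < r)%N. Proof. by case: r q_gt1. Qed.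
Let q1' : q.-1%:R != 0 :> rat. Proof. by rewrite pnatr_eq0 -lt0n. Qed.

Definition hyp_factor (y : rat) (n k : nat) : L :=
  gamma_rat L (frac_part (n%:R * y * p%:R ^+ k)) *
  (- p%:R) ^ (- Num.floor (n%:R * y * p%:R ^+ k)).

Lemma hyp_term_unit_frac (e : int) y n c : `|e|%N = 1%N -> ~~ (p %| n)%N ->
  (c < q.-1)%N -> n%:R * y - c%:R / q.-1%:R \is a Num.int ->
  \prod_(h <- iota 0 n) \prod_(0 <= k < r) hyp_term L e y k (h%:R / n%:R) =
  w n ^+ c * \prod_(0 <= k < r) hyp_factor y n k.
Proof.
move=> e1 pn c_lt nyc; rewrite exchange_big /= (teichmuller_nat F_card L_unram pn).
have := gamma_term_multiplication p_odd L r_gt0 pn e1 c_lt nyc.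
by rewrite /index_iota !subn0.
Qed.

Lemma hyp_term_unit_fracs_pos j ns : all (fun n => ~~ (p %| n)%N) ns ->
  \prod_(x <- unit_fracs ns) \prod_(0 <= k < r) hyp_term L (-1) (j%:R / q.-1%:R) k x =
  \prod_(n <- ns) w n ^+ (n * j) *
  \prod_(n <- ns) \prod_(0 <= k < r) hyp_factor (j%:R / q.-1%:R) n k.
Proof.
move=> /allP nsp; rewrite /unit_fracs big_flatten big_map -big_split /=.
apply: eq_big_seq => n /nsp pn; rewrite big_map.
rewrite (@hyp_term_unit_frac _ _ _ ((n * j) %% q.-1)) ?ltn_mod //.
  by rewrite (expr_mod _ (teichmuller_nat_exp F_card L_unram pn)).
have -> : n%:R * (j%:R / q.-1%:R) - ((n * j) %% q.-1)%:R / q.-1%:R =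
    ((n * j) %/ q.-1)%:R :> rat.
  have := congr1 (fun i => i%:R : rat) (divn_eq (n * j) q.-1).
  by rewrite natrD !natrM => nj; apply: (mulIf q1'); rewrite mulrBl mulrA !divfK // nj addrK.
exact: natr_int.
Qed.

(** The lift of n would get the exponent - n j; its inverse is kept on the left to stay with natural
    exponents. *)
Lemma hyp_term_unit_fracs_neg j ns : all (fun n => ~~ (p %| n)%N) ns ->
  (\prod_(x <- unit_fracs ns) \prod_(0 <= k < r) hyp_term L 1 (- (j%:R / q.-1%:R)) k x) *
    \prod_(n <- ns) w n ^+ (n * j) =
  \prod_(n <- ns) \prod_(0 <= k < r) hyp_factor (- (j%:R / q.-1%:R)) n k.
Proof.
move=> /allP nsp; rewrite /unit_fracs big_flatten big_map -big_split /=.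
apply: eq_big_seq => n /nsp pn; rewrite big_map.
set d := ((n * j) %% q.-1)%N; have dq : (d < q.-1)%N by rewrite ltn_mod.
have wq := teichmuller_nat_exp F_card L_unram pn.
(* The representative of - n j modulo q - 1; the outer reduction matters when d = 0. *)
rewrite (@hyp_term_unit_frac _ _ _ ((q.-1 - d) %% q.-1)) ?ltn_mod //.
  rewrite mulrAC -exprD -[RHS]mul1r; congr (_ * _).
  by rewrite -(expr_mod _ wq) modnDml -modnDmr -/d subnK 1?ltnW // modnn.
set B := ((q.-1 - d) %/ q.-1)%N; set A := ((n * j) %/ q.-1)%N.
have dE : d%:R = n%:R * j%:R - A%:R * q.-1%:R :> rat.
  by rewrite -!natrM [X in X%:R - _](divn_eq _ q.-1) natrD addrC addKr.
have cE : ((q.-1 - d) %% q.-1)%:R = q.-1%:R - d%:R - B%:R * q.-1%:R :> rat.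
  by rewrite -natrB 1?ltnW // [X in X%:R - _](divn_eq _ q.-1) natrD natrM addrC addKr.
have -> : n%:R * - (j%:R / q.-1%:R) - ((q.-1 - d) %% q.-1)%:R / q.-1%:R =
    - (A%:R + 1 - B%:R) :> rat by rewrite cE dE; field.
by rewrite rpredN rpredB ?rpredD ?natr_int.
Qed.

End UnitFracsTerm.

(** The algebra of one summand: v is (-1)^(j delta), A and B are inverse powers of q, w and w' the
    products of Teichmuller lifts for the p_i and the q_i, T and T' the characters at M lambda and
    lambda, Y the product over the a_i and b_i, and P, Q the products over the exponents. *)
Lemma cancel_common (K : fieldType) (u v A B T T' w w' Y P Q : K) :
  v * v = 1 -> A * B = 1 -> w' != 0 -> w * T = w' * T' -> Y * v * B * w = P * (w' * Q) ->
  u * T' * Y = u * v * A * T * (P * Q).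
Proof.
move=> vv AB w0 wT YP; apply: (mulfI w0); transitivity (u * Y * (w' * T')); first by ring.
rewrite -wT; transitivity (u * v * A * T * (P * (w' * Q))); last by ring.
by rewrite -YP; transitivity (u * Y * (w * T) * (v * v) * (A * B)); [rewrite vv AB !mulr1 | ring].
Qed.

Theorem theorem2p7
  (p r : nat) (p_pr : prime p) (p_odd : odd p)
  (F : finFieldType) (F_card : #|F| = (p ^ r)%N)
  (L : fieldExtType (padic p_pr)) (res : L -> F)
  (L_unram : unramified_residue res)
  (R : realType)
  (lambda : F) (m : nat) (m_gt0 : (0 < m)%N) (a b : 'I_m -> rat)
  (a_int : forall i, padic_integral_rat p_pr (a i))
  (b_int : forall i, padic_integral_rat p_pr (b i))
  (ab_disjoint : forall i j, a i - b j \isn't a Num.int)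
  (ps qs : seq nat) (ab_rat : defined_over_rat R a b ps qs) :
  let q := (p ^ r)%N in
  let delta := common_degree R ps qs in
  let s := common_mult R ps qs q in
  let M : F := ratr (exponent_const ps qs) in
  let x (j n k : nat) : rat := j%:R * n%:R / q.-1%:R * p%:R ^+ k in
  mGm res r a b lambda =
  -1 / q.-1%:R *
  \sum_(0 <= j < q.-1)
    (-1) ^+ (j * (m + delta)) * q%:R ^ (- (s 0%N)%:Z + (s j)%:Z) *
    teichmuller_bar res j (M * lambda) *
    \prod_(0 <= k < r)
      ((\prod_(n <- ps)
          (gamma_rat L (frac_part (- x j n k)) *
           (- p%:R) ^ (- Num.floor (- x j n k)))) *
       (\prod_(n <- qs)
          (gamma_rat L (frac_part (x j n k)) *
           (- p%:R) ^ (- Num.floor (x j n k))))).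
Proof.
move=> q delta s M x.
have ap i : p_integral p (a i) by exact: padic_integral_ratP.
have bp i : p_integral p (b i) by exact: padic_integral_ratP.
have [psp qsp] := exponents_coprime p_pr ap bp ab_rat.
have [S [[SP SQ] S_perm S_int deltaE sE]] := common_fracs p_pr ap bp ab_disjoint ab_rat.
have q_gt1 : (1 < q)%N by rewrite /q -F_card finNzRing_gt1.
have q1_gt0 : (0 < q.-1)%N by rewrite -ltnS prednK // ltnW.
have r_gt0 : (0 < r)%N by rewrite lt0n; apply: contraTneq q_gt1 => r0; rewrite /q r0.
have q0 : q%:R != 0 :> L by rewrite natr_neq0_ext // ltnW.
rewrite /mGm; congr (_ * _); apply: eq_big_nat => j /andP[_ jq].
pose t : rat := j%:R / q.-1%:R.
pose HA y := \prod_(0 <= k < r) hyp_term L 1 (- t) k y.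
pose HB y := \prod_(0 <= k < r) hyp_term L (-1) t k y.
pose HP := \prod_(n <- ps) \prod_(0 <= k < r) hyp_factor L (- t) n k.
pose HQ := \prod_(n <- qs) \prod_(0 <= k < r) hyp_factor L t n k.
pose X := (\prod_(y <- param_fracs a) HA y) * (\prod_(y <- param_fracs b) HB y).
pose W ns := \prod_(n <- ns) (teichmuller res n%:R) ^+ (n * j).
set lhs := \prod_(i < m) _; have {lhs}-> : lhs = X.
  rewrite /lhs /X !big_map -big_split /=; apply: eq_bigr => i _.
  rewrite /HA /HB -big_split /=; apply: eq_bigr => k _.
  rewrite (hyp_term_congr _ 1 _ _ (x' := a i)); last first.
    by rewrite -rpredN opprB frac_partB_int.
  rewrite (hyp_term_congr _ (-1) _ _ (x' := b i)); last first.
    by rewrite -rpredN opprB frac_partB_int.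
  rewrite /hyp_term rmorph1 rmorphN1 mulN1r !mul1r [RHS]mulrACA.
  have tE : j%:R * p%:R ^+ k / q.-1%:R = t * p%:R ^+ k :> rat by rewrite /t; ring.
  by rewrite -expfzDr ?oppr_p_neq0 // !tE (mulNr t).
set rhs := \prod_(0 <= k < r) _; have {rhs}-> : rhs = HP * HQ.
  rewrite /rhs big_split /= exchange_big /= [X in _ * X]exchange_big /=.
  congr (_ * _); apply: eq_bigr => n _; apply: eq_bigr => k _; rewrite /hyp_factor.
    by have -> : n%:R * - t * p%:R ^+ k = - x j n k by rewrite /x /t; ring.
  by have -> : n%:R * t * p%:R ^+ k = x j n k by rewrite /x /t; ring.
have common := hyp_term_common p_odd L r_gt0 q1_gt0 jq S_int S_perm.
(* The sign and the power of q are the product of the factors over [S], which completes both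
   products in [X] to all of [unit_fracs]. *)
have XE : X * (-1) ^+ (j * delta) * q%:R ^ ((s 0%N)%:Z - (s j)%:Z) * W ps = HP * (W qs * HQ).
  have HPE : (\prod_(y <- unit_fracs ps) HA y) * W ps = HP :=
    hyp_term_unit_fracs_neg p_odd F_card L_unram j psp.
  have HQE : \prod_(y <- unit_fracs qs) HB y = W qs * HQ :=
    hyp_term_unit_fracs_pos p_odd F_card L_unram j qsp.
  rewrite -HPE -HQE (perm_big _ SP) (perm_big _ SQ) !big_cat /= /s !sE // mul0r /delta deltaE.
  rewrite -[X * _ * _]mulrA -common.
  under [in LHS]eq_bigr do rewrite big_split.
  by rewrite big_split /= /X; ring.
have WQ0 : W qs != 0.
  rewrite prodf_seq_neq0; apply/allP => n /(allP qsp) pn /=.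
  by rewrite expf_neq0 // (teichmuller_nat_neq0 F_card L_unram).
have MW := teichmuller_barM F_card L_unram j lambda psp qsp.
rewrite -/(W ps) -/(W qs) -/M in MW.
have sgn2 : (-1) ^+ (j * delta) * (-1) ^+ (j * delta) = 1 :> L.
  by rewrite -expr2 sqrr_sign.
have q2 : q%:R ^ (- (s 0%N)%:Z + (s j)%:Z) * q%:R ^ ((s 0%N)%:Z - (s j)%:Z) = 1 :> L.
  by rewrite -expfzDr // addrACA addNr add0r subrr expr0z.
rewrite mulnDr exprD; exact: (cancel_common _ sgn2 q2 WQ0 MW XE).
Qed.
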